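(* Let $h$ be a centered (possibly degenerate) Gaussian random variable satisfying $\mathbb{E}e^{2|h|}<\left(\max_{\beta\ge0}\frac{\beta}{\cosh^2\beta}\right)^{-1}$. For $0<u<1$, we have $\Omega(\beta,\boldsymbol{\beta},h)\subset[-1,-u)\cup(u,1]$ for all $(\beta,\boldsymbol{\beta})\in\mathcal{R}_u$.
   Context: Let $\mathcal{B}=\{(\beta,\boldsymbol{\beta}):\boldsymbol{\beta}=(\beta_p)_{p\ge1}\subset\mathbb{R},\ \beta\ge 0,\ \sum_{p\ge1}2^p\beta_p^2<\infty\}$. Let $(h_i)$ be i.i.d. copies of a Gaussian random variable $h$ and $(g_{i_1,\ldots,i_{2p}})$ i.i.d. standard Gaussians independent of $(h_i)$. For $\boldsymbol{\sigma}\in\Sigma_N=\{-1,+1\}^N$ set $$H_N^{SK}(\boldsymbol{\sigma})=\sum_{p\ge1}\frac{\beta_p}{N^{p-1/2}}\sum_{1\le i_1,\ldots,i_{2p}\le N}g_{i_1,\ldots,i_{2p}}\sigma_{i_1}\cdots\sigma_{i_{2p}},$$ and let $F^{SK}(\boldsymbol{\beta},h)=\lim_{N\to\infty}N^{-1}\mathbb{E}\ln\sum_{\boldsymbol{\sigma}\in\Sigma_N}\exp\left(H_N^{SK}(\boldsymbol{\sigma})+\sum_{i\le N}h_i\sigma_i\right)$ (the limit is known to exist for every Gaussian $h$). For $x\in\mathbb{R}$, $F^{SK}(\boldsymbol{\beta},x+h)$ means $h_i$ is replaced by $x+h_i$. Let $\xi(x)=\sum_{p\ge1}\beta_p^2x^{2p}$.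 $\Omega(\beta,\boldsymbol{\beta},h)=\mathrm{Argmax}_{\mu\in[-1,1]}\{F^{SK}(\boldsymbol{\beta},\beta\mu+h)-\beta\mu^2/2\}$. $\mathcal{B}_d$ is the set of $(\beta,\boldsymbol{\beta})\in\mathcal{B}$ with $\beta>0$ such that either $|\Omega(\beta,\boldsymbol{\beta},h)|=1$ or $\Omega(\beta,\boldsymbol{\beta},h)=\{\mu,-\mu\}$ for some $0<\mu<1$. $\mathcal{B}'$ is the set of $(\beta,\boldsymbol{\beta})\in\mathcal{B}$ with $\beta>0$ and $\beta_p\ne0$ for all $p\ge1$. $\mathcal{B}_d'=\mathcal{B}_d\cap\mathcal{B}'$. Let $\alpha$ be defined by $\alpha\,\mathbb{E}\frac{1}{\cosh^2h}=1$ and, for $\mu\in[-1,1]$, $\beta\in(\alpha,\infty)$, let $f(\mu,\beta)=\ln2+\mathbb{E}\ln\cosh(\beta\mu+h)-\frac{\beta\mu^2}{2}$. For each $\beta>\alpha$, $f(\cdot,\beta)$ has a unique maximizer $\mu(\beta)\in(0,1)$ over $[0,1]$, and $\beta\mapsto\mu(\beta)$ is a continuous, strictly increasing bijection from $(\alpha,\infty)$ onto $(0,1)$. For $0<u<1$ let $\beta_u\in(\alpha,\infty)$ be the unique number with $\mu(\beta_u)=u$, and define $\delta_u(\beta)=f(\mu(\beta),\beta)-f(u,\beta)$ for $\beta\ge\beta_u$. Finally $$\mathcal{R}_u=\{(\beta,\boldsymbol{\beta})\in\mathcal{B}_d':\ \beta>\beta_u\ \text{and}\ \xi(1)<2\delta_u(\beta)\}.$$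 *)

(* Defs.v *)
From HB Require Import structures.
From mathcomp Require Import all_boot all_order all_algebra.
From mathcomp Require Import all_classical all_reals all_analysis.

Set Implicit Arguments.
Unset Strict Implicit.
Unset Printing Implicit Defensive.

Import Order.TTheory GRing.Theory Num.Theory.
Import numFieldNormedType.Exports.

Local Open Scope classical_set_scope.
Local Open Scope ring_scope.

Definition cosh (R : realType) (x : R) : R := (expR x + expR (- x)) / 2.

Definition mean d (T : measurableType d) (R : realType) (P : probability T R)
  (X : T -> R) : R := fine 'E_P[X].

(* [normal_prob 0 0] is not the Dirac mass at 0 (it is the uniform law on
   [0, 1]), so the degenerate case is treated separately. *)
Definition centered_gaussian_law (R : realType) (s : R) (A : set R) : \bar R :=
  if s == 0 then \d_(0 : R) A else normal_prob 0 s A.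

Definition is_centered_gaussian d (T : measurableType d) (R : realType)
    (P : probability T R) (X : {RV P >-> R}) : Prop :=
  exists2 s : R, 0 <= s &
    forall A, measurable A -> distribution P X A = centered_gaussian_law s A.

Definition is_standard_gaussian d (T : measurableType d) (R : realType)
    (P : probability T R) (X : {RV P >-> R}) : Prop :=
  forall A, measurable A -> distribution P X A = normal_prob 0 1 A.

Definition same_law d (T : measurableType d) (R : realType)
    (P : probability T R) (X Y : {RV P >-> R}) : Prop :=
  forall A, measurable A -> distribution P X A = distribution P Y A.

Definition mutually_independent d (T : measurableType d) (R : realType)
    (P : probability T R) (I : choiceType) (D : set I)
    (X : I -> {RV P >-> R}) : Prop :=
  forall (s : seq I) (B : I -> set R),
    uniq s -> [set` s] `<=` D -> (forall i, measurable (B i)) ->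
    P (\bigcap_(i in [set` s]) (X i @^-1` B i)) =
    (\prod_(i <- s) P (X i @^-1` B i))%E.

(* The couplings g_{i_1, ..., i_{2p}} (p >= 1) are indexed by the nonempty words
   [:: i_1; ...; i_{2p}] of even length; g is irrelevant on all other words.
   Site indices start at 0 instead of 1. *)
Definition coupling_word (w : seq nat) : bool := (0 < size w)%N && ~~ odd (size w).

Definition disorder d (T : measurableType d) (R : realType)
    (P : probability T R) (g : seq nat -> {RV P >-> R})
    (hs : nat -> {RV P >-> R}) (k : seq nat + nat) : {RV P >-> R} :=
  match k with inl w => g w | inr i => hs i end.

Definition is_disorder d (T : measurableType d) (R : realType)
    (P : probability T R) (h : {RV P >-> R}) (g : seq nat -> {RV P >-> R})
    (hs : nat -> {RV P >-> R}) : Prop :=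
  [/\ mutually_independent
        [set k : seq nat + nat | if k is inl w then coupling_word w else true]
        (disorder g hs),
      forall w, coupling_word w -> is_standard_gaussian (g w)
    & forall i, same_law (hs i) h].

(* A sequence (beta_p)_{p >= 1} is a function on nat whose value at 0 is never
   used. *)
Definition Bparam (R : realType) (beta : R) (bs : nat -> R) : Prop :=
  0 <= beta /\ (\sum_(1 <= p <oo) (2 ^+ p * bs p ^+ 2)%:E < +oo)%E.

Definition xi (R : realType) (bs : nat -> R) (x : R) : R :=
  limn (fun n => \sum_(1 <= p < n) bs p ^+ 2 * x ^+ (2 * p)).

(* A configuration in {-1, +1}^N is encoded by booleans. *)
Definition spin (R : realType) (N : nat) (sigma : {ffun 'I_N -> bool})
  (i : 'I_N) : R := if sigma i then 1 else -1.

Definition HSK d (T : measurableType d) (R : realType) (P : probability T R)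
    (g : seq nat -> {RV P >-> R}) (bs : nat -> R) (N : nat)
    (sigma : {ffun 'I_N -> bool}) (w : T) : R :=
  limn (fun n => \sum_(1 <= p < n)
    (bs p / N%:R `^ (p%:R - 2^-1) *
     \sum_(t : (2 * p).-tuple 'I_N)
       g [seq val i | i <- t] w * \prod_(i <- t) spin R sigma i)).

(* (1/N) E ln Z_N, with the external fields h_i replaced by x + h_i. *)
Definition free_energy d (T : measurableType d) (R : realType)
    (P : probability T R) (g : seq nat -> {RV P >-> R})
    (hs : nat -> {RV P >-> R}) (bs : nat -> R) (x : R) (N : nat) : R :=
  N%:R^-1 * mean P (fun w =>
    ln (\sum_(sigma : {ffun 'I_N -> bool})
          expR (HSK g bs sigma w + \sum_(i < N) (x + hs i w) * spin R sigma i))).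

(* F is the function x |-> F^SK(bs, x + h). *)
Definition is_FSK d (T : measurableType d) (R : realType)
    (P : probability T R) (g : seq nat -> {RV P >-> R})
    (hs : nat -> {RV P >-> R}) (bs : nat -> R) (F : R -> R) : Prop :=
  forall x, free_energy g hs bs x N @[N --> \oo] --> F x.

(* The limit defining F^SK exists for every x and is unique, so that F below is
   determined by is_FSK. *)
Definition Omega d (T : measurableType d) (R : realType)
    (P : probability T R) (g : seq nat -> {RV P >-> R})
    (hs : nat -> {RV P >-> R}) (beta : R) (bs : nat -> R) : set R :=
  [set m | -1 <= m <= 1 /\
    exists2 F : R -> R, is_FSK g hs bs F &
      forall m', -1 <= m' <= 1 ->
        F (beta * m') - beta * m' ^+ 2 / 2 <= F (beta * m) - beta * m ^+ 2 / 2].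

Definition Bd d (T : measurableType d) (R : realType)
    (P : probability T R) (g : seq nat -> {RV P >-> R})
    (hs : nat -> {RV P >-> R}) (beta : R) (bs : nat -> R) : Prop :=
  [/\ Bparam beta bs, 0 < beta &
      (exists m, Omega g hs beta bs = [set m]) \/
      (exists2 m, 0 < m < 1 & Omega g hs beta bs = [set m; - m])].

Definition Bprime (R : realType) (beta : R) (bs : nat -> R) : Prop :=
  [/\ Bparam beta bs, 0 < beta & forall p, (0 < p)%N -> bs p != 0].

Definition Bd_prime d (T : measurableType d) (R : realType)
    (P : probability T R) (g : seq nat -> {RV P >-> R})
    (hs : nat -> {RV P >-> R}) (beta : R) (bs : nat -> R) : Prop :=
  Bd g hs beta bs /\ Bprime beta bs.

Definition alpha d (T : measurableType d) (R : realType)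
    (P : probability T R) (h : {RV P >-> R}) : R :=
  (mean P (fun w => (cosh (h w) ^+ 2)^-1))^-1.

Definition fCW d (T : measurableType d) (R : realType)
    (P : probability T R) (h : {RV P >-> R}) (m beta : R) : R :=
  ln 2 + mean P (fun w => ln (cosh (beta * m + h w))) - beta * m ^+ 2 / 2.

(* [get A] is the element of A when A is a singleton. *)
Definition mu_of d (T : measurableType d) (R : realType)
    (P : probability T R) (h : {RV P >-> R}) (beta : R) : R :=
  get [set m : R | 0 <= m <= 1 /\
    forall m', 0 <= m' <= 1 -> fCW h m' beta <= fCW h m beta].

Definition beta_of d (T : measurableType d) (R : realType)
    (P : probability T R) (h : {RV P >-> R}) (u : R) : R :=
  get [set b : R | alpha h < b /\ mu_of h b = u].

Definition delta d (T : measurableType d) (R : realType)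
    (P : probability T R) (h : {RV P >-> R}) (u beta : R) : R :=
  fCW h (mu_of h beta) beta - fCW h u beta.

Definition Rset d (T : measurableType d) (R : realType)
    (P : probability T R) (h : {RV P >-> R}) (g : seq nat -> {RV P >-> R})
    (hs : nat -> {RV P >-> R}) (u beta : R) (bs : nat -> R) : Prop :=
  [/\ Bd_prime g hs beta bs, beta_of h u < beta & xi bs 1 < 2 * delta h u beta].

(* The supremum is the maximum of b / cosh^2 b over b >= 0: this continuous
   function tends to 0 at infinity. *)
Definition max_ratio (R : realType) : R :=
  sup [set b / cosh b ^+ 2 | b in [set b : R | 0 <= b]].

(* Main.v *)
(* Integrating out the couplings g by Jensen's inequality in both directions gives
   f0 (x) <= F^SK (x + h) <= f0 (x) + xi(1) / 2,   f0 (x) = ln 2 + E ln cosh (x + h).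
   If a maximizer m satisfied |m| <= u, then, as f(., beta) is even and nondecreasing
   on [0, u] for beta > beta_u,
   F(beta m) - beta m^2 / 2 <= f(u, beta) + xi(1) / 2 < f(mu(beta), beta)
     <= F(beta mu(beta)) - beta mu(beta)^2 / 2,
   a contradiction.  That beta_u is well defined (i.e. that f(., b) has u as unique
   maximizer for some b > alpha) comes from t |-> E cosh^-2 (t + h) being strictly
   decreasing on [0, +oo[, which holds since a centered Gaussian law is symmetric and
   unimodal. *)
Require Import Defs.
From HB Require Import structures.
From mathcomp Require Import all_boot all_order all_algebra.
From mathcomp Require Import all_classical all_reals all_analysis.
From mathcomp Require Import measurable_realfun ring lra.

Set Implicit Arguments.
Unset Strict Implicit.
Unset Printing Implicit Defensive.

Import Order.TTheory GRing.Theory Num.Theory.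
Import numFieldNormedType.Exports.

Local Open Scope classical_set_scope.
Local Open Scope ring_scope.

(** * Hyperbolic functions and the mean-field equation *)

Section hyperbolic.
Context {R : realType}.
Implicit Types x y r : R.

(** Jensen is applied to the partition function divided by that of the fields alone. The fields
    alone give a configuration the weight [\prod_i e^((x + h_i) sigma_i) / (2 cosh (x + h_i))].
    These weights sum to 1 and are independent of the couplings, and the partition function is
    [\prod_i 2 cosh (x + h_i)] times the weighted mean [Y] of [e^H]. Convexity of [exp] bounds
    [ln Y] below by the weighted mean of [H], whose expectation is 0; concavity of [ln] bounds
    [E ln Y] above through [E Y <= e^(N xi(1) / 2)], as [H] has variance [N xi(1)]. The obstacle is
    that [H] is an infinite random series given by a pointwise [limn]: it has to be shown measurable
    and almost surely convergent, and what is computed for partial sums has to survive the limit, by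
    dominated convergence for the mean and by Fatou for the exponential. The comparison of
    [f(m, beta)] with [f(u, beta)] does not use the sign of a derivative in [m]: the optimality of
    [u] at [beta_u] is transported to every larger [beta]. *)

Definition sinh x : R := (expR x - expR (- x)) / 2.
Definition tanh x : R := sinh x / cosh x.

Lemma cosh_gt0 x : 0 < cosh x.
Proof. by rewrite divr_gt0// addr_gt0// expR_gt0. Qed.

Lemma coshN x : cosh (- x) = cosh x.
Proof. by rewrite /cosh opprK addrC. Qed.

Lemma sinhN x : sinh (- x) = - sinh x.
Proof. by rewrite /sinh opprK -mulNr opprB. Qed.

Lemma tanhN x : tanh (- x) = - tanh x.
Proof. by rewrite /tanh sinhN coshN mulNr. Qed.

Lemma sqr_cosh_sinh x : cosh x ^+ 2 - sinh x ^+ 2 = 1.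
Proof.
rewrite -[RHS](expRxMexpNx_1 x) /cosh /sinh.
by set a := expR x; set b := expR (- x); field.
Qed.

Lemma sinh_gt0 x : 0 < x -> 0 < sinh x.
Proof.
by move=> x0; rewrite divr_gt0// subr_gt0 ltr_expR; lra.
Qed.

Lemma cosh_ge1 x : 1 <= cosh x.
Proof.
rewrite -(@ler_pXn2r _ 2)// ?nnegrE ?(ltW (cosh_gt0 x))// expr1n.
by rewrite -(sqr_cosh_sinh x) gerBl sqr_ge0.
Qed.

Lemma norm_tanh_le1 x : `|tanh x| <= 1.
Proof.
rewrite ler_norml /tanh ler_pdivlMr ?cosh_gt0// ler_pdivrMr ?cosh_gt0//.
rewrite /sinh /cosh; have := expR_gt0 x; have := expR_gt0 (- x); lra.
Qed.

Lemma coshD_sub x y : cosh (x + y) - cosh (x - y) = 2 * (sinh x * sinh y).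
Proof.
by rewrite /cosh /sinh !opprD opprK !expRD; field.
Qed.

Global Instance is_derive_cosh x : is_derive x 1 (@cosh R) (sinh x).
Proof.
have -> : @cosh R = (2^-1 : R) \*: ((@expR R) + (@expR R \o -%R)).
  by apply/funext => y; rewrite /cosh /= mulrC.
by apply: is_derive_eq; rewrite /sinh /= -![_ *: _]/(_ * _); field.
Qed.

Global Instance is_derive_sinh x : is_derive x 1 sinh (cosh x).
Proof.
have -> : sinh = (2^-1 : R) \*: ((@expR R) - (@expR R \o -%R)).
  by apply/funext => y; rewrite /sinh /= mulrC.
by apply: is_derive_eq; rewrite /cosh /= -![_ *: _]/(_ * _); field.
Qed.

Global Instance is_derive_ln_cosh x : is_derive x 1 (fun y => ln (cosh y)) (tanh x).
Proof.
have lnc := is_derive1_ln (cosh_gt0 x).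
by apply: is_derive_eq; rewrite mulrC.
Qed.

Global Instance is_derive_tanh x : is_derive x 1 tanh (cosh x ^+ 2)^-1.
Proof.
have c0 : cosh x != 0 by rewrite gt_eqF// cosh_gt0.
have -> : tanh = sinh * (fun y => (cosh y)^-1) by [].
have dV := is_deriveV c0 (is_derive_cosh x).
apply: is_derive_eq; rewrite -![_ *: _]/(_ * _).
rewrite -[RHS]mul1r -(sqr_cosh_sinh x); field.
exact: c0.
Qed.

Lemma ln_cosh_ge0 x : 0 <= ln (cosh x).
Proof. exact/ln_ge0/cosh_ge1. Qed.

Lemma ln_cosh_le_norm x : ln (cosh x) <= `|x|.
Proof.
rewrite -ler_expR lnK ?posrE ?cosh_gt0//.
have -> : cosh x = cosh `|x|.
  by have [//|] := ger0P x; rewrite coshN.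
rewrite /cosh ler_pdivrMr// mulr2n mulrDr mulr1 lerD2l ler_expR.
by rewrite (le_trans _ (normr_ge0 x))// oppr_le0.
Qed.

(** The difference equals [e^(-x) / cosh x]. The decay rate 2 is the one matched by the moment
    [E e^(2|h|)] when [E tanh (M + h)] is shown to approach 1. *)
Lemma one_sub_tanh_le x : 1 - tanh x <= 2 * expR (- (2 * x)).
Proof.
have -> : 2 * x = x + x by ring.
rewrite opprD expRD.
have -> : 1 - tanh x = (cosh x - sinh x) / cosh x.
  by rewrite mulrBl divff// gt_eqF// cosh_gt0.
rewrite ler_pdivrMr ?cosh_gt0//.
have -> : cosh x - sinh x = expR (- x) by rewrite /cosh /sinh; field.
rewrite /cosh; have /= := expRxMexpNx_1 x; have := expR_gt0 (- x); have := expR_gt0 x.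
set a := expR x; set b := expR (- x) => a0 b0 ab.
have -> : 2 * (b * b) * ((a + b) / 2) = b * (a * b) + b * b * b by field.
by rewrite ab mulr1 lerDl !mulr_ge0// ltW.
Qed.

(** By [coshD_sub] the two hyperbolic cosines differ by [2 sinh x sinh y > 0]. This is the
    positivity that [gaussian_odd_gt0] asks of its odd function. *)
Lemma inv_sqr_cosh_lt x y : 0 < x -> 0 < y ->
  (cosh (x + y) ^+ 2)^-1 < (cosh (x - y) ^+ 2)^-1.
Proof.
move=> x0 y0; rewrite ltf_pV2 ?posrE ?exprn_gt0 ?cosh_gt0//.
rewrite ltr_pXn2r ?nnegrE ?(ltW (cosh_gt0 _))// -subr_gt0 coshD_sub.
by apply: mulr_gt0 => //; apply: mulr_gt0; exact: sinh_gt0.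
Qed.

Lemma inv_sqr_cosh_le1 x : 0 <= (cosh x ^+ 2)^-1 <= 1.
Proof.
rewrite invr_ge0 sqr_ge0/= invf_le1 ?exprn_gt0 ?cosh_gt0//.
by rewrite exprn_ege1// cosh_ge1.
Qed.

End hyperbolic.

(** * Maximizers of [L (b m) - b m^2 / 2] for an abstract potential [L] *)

Section mean_field.
Context {R : realType}.

Lemma is_derive_continuous (f df : R -> R) :
  (forall x : R, is_derive x 1 f (df x)) -> continuous f.
Proof. by move=> fdf x; apply: differentiable_continuous; apply/derivable1_diffP. Qed.

Lemma MVT_real (f df : R -> R) (a b : R) :
  (forall x : R, is_derive x 1 f (df x)) -> a < b ->
  exists2 c, a < c < b & f b - f a = df c * (b - a).
Proof.
move=> fdf ab.
have [|c /[!in_itv]/= cab fE] := MVT ab (fun x _ => fdf x); last by exists c.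
exact/continuous_subspaceT/(is_derive_continuous fdf).
Qed.

(** These will be [t |-> E ln cosh (t + h)] and its first two derivatives [E tanh (t + h)] and
    [E cosh^-2 (t + h)]. *)
Variables (L f df : R -> R).
Hypothesis dL : forall x : R, is_derive x 1 L (f x).
Hypothesis d2L : forall x : R, is_derive x 1 f (df x).

Lemma is_derive_scaled (b s : R) :
  is_derive s 1 (fun s => L (b * s)) (b * f (b * s)).
Proof.
have d : is_derive ((b \*: id) s) 1 L (f (b * s)) := dL _.
have -> : (fun s => L (b * s)) = L \o (b \*: id) by [].
by apply: is_derive_eq; rewrite -![_ *: _]/(_ * _) mulr1 mulrC.
Qed.

(* [b^-1 (L (b u) - L (b m))] is nondecreasing in [b], being the integral of
   [s |-> f (b s)] over [m, u]. *)
Lemma mean_field_monotone (b c u m : R) : {homo f : x y / x <= y} ->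
  0 < c -> c <= b -> 0 <= m <= u ->
  L (c * m) - c * m ^+ 2 / 2 <= L (c * u) - c * u ^+ 2 / 2 ->
  L (b * m) - b * m ^+ 2 / 2 <= L (b * u) - b * u ^+ 2 / 2.
Proof.
move=> fmono c0 cb /andP[m0 mu].
have b0 : 0 < b by exact: lt_le_trans cb.
pose q s := L (b * s) / b - L (c * s) / c.
have dq (s : R) : is_derive s 1 q (f (b * s) - f (c * s)).
  have -> : q = (b^-1 \*: (fun s => L (b * s))) - (c^-1 \*: (fun s => L (c * s))).
    by apply/funext => t; rewrite /q /= mulrC [_ / c]mulrC.
  have db := is_derive_scaled b s; have dc := is_derive_scaled c s.
  apply: is_derive_eq; rewrite -![_ *: _]/(_ * _); field.
  by rewrite !gt_eqF.
have : q m <= q u.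
  move: mu; rewrite le_eqVlt => /predU1P[->//|mu].
  have [s /andP[ms su] qE] := MVT_real dq mu.
  rewrite -subr_ge0 qE mulr_ge0 ?subr_ge0 ?(ltW mu)// fmono// ler_wpM2r//.
  exact: le_trans (ltW ms).
rewrite /q => qmu maxc.
have {maxc} : (L (c * m) - L (c * u)) / c <= (m ^+ 2 - u ^+ 2) / 2.
  rewrite ler_pdivrMr//; lra.
move=> maxc; have : (L (b * m) - L (b * u)) / b <= (m ^+ 2 - u ^+ 2) / 2.
  by lra.
rewrite ler_pdivrMr//; lra.
Qed.

Hypothesis f0 : f 0 = 0.
Hypothesis df_gt0 : forall x : R, 0 <= x -> 0 < df x.
Hypothesis df_decr : forall x y : R, 0 <= x -> x < y -> df y < df x.

(* [b := y / u] where [f y = u]. *)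
Lemma mean_field_maximizer (u M : R) : 0 < u -> 0 <= M -> u <= f M ->
  exists2 b : R, (df 0)^-1 < b & forall m : R, 0 <= m -> m != u ->
      L (b * m) - b * m ^+ 2 / 2 < L (b * u) - b * u ^+ 2 / 2.
Proof.
move=> u0 M0 fM.
have cf : continuous f by exact: is_derive_continuous d2L.
have [y /[!in_itv]/= /andP[y0 yM] fy] : exists2 c, c \in `[0, M] & f c = u.
  apply: IVT => //; first exact: continuous_subspaceT.
  by rewrite f0 min_l ?max_r ?(ltW u0)// (le_trans (ltW u0)).
have {}y0 : 0 < y.
  by rewrite lt_neqAle y0 andbT; apply/eqP => y0'; move: u0; rewrite -fy -y0' f0 ltxx.
exists (y / u).
  (* By the mean value theorem [u = f y = df c * y] with [0 < c], hence
     [y / u = 1 / df c > 1 / df 0]. *)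
  have [c /andP[c0 cy] fE] := MVT_real d2L y0.
  move: fE; rewrite f0 !subr0 fy => ->.
  rewrite invfM mulrCA divff ?gt_eqF// mulr1 ltf_pV2 ?posrE ?df_gt0 ?(ltW c0)//.
  exact: df_decr.
(* In the variable [t = b m] the objective becomes [k t = L t - t^2 / (2 b)] with [1 / b = u / y],
   and [g] is its derivative. As [g] vanishes at 0 and [y] and [df] is strictly decreasing, [k]
   increases up to [y] and decreases afterwards. *)
pose g t := f t - t * (u / y).
have dg (t : R) : is_derive t 1 g (df t - u / y).
  have -> : g = f - ((u / y) \*: id) by apply/funext => r; rewrite /g mulrC.
  have d := d2L t.
  by apply: is_derive_eq; rewrite -![_ *: _]/(_ * _) mulr1.
have g0 : g 0 = 0 by rewrite /g f0 mul0r subr0.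
have gy : g y = 0 by rewrite /g fy mulrCA divff ?gt_eqF// mulr1 subrr.
pose k t := L t - t ^+ 2 * (u / y) / 2.
have dk (t : R) : is_derive t 1 k (g t).
  have -> : k = L - ((u / y / 2) \*: (@id R) ^+ 2).
    apply/funext => r; rewrite -[RHS]/(L r - u / y / 2 * r ^+ 2) /k.
    by rewrite -mulrA mulrC.
  have d := dL t.
  apply: is_derive_eq; rewrite -![_ *: _]/(_ * _) /g /=; field.
  by rewrite gt_eqF.
(* If [g t <= 0] inside, [g] would have a slope [<= 0] somewhere before [t] and a slope [>= 0]
   somewhere after it, against the strict decrease of [df]. *)
have g_gt0 t : 0 < t -> t < y -> 0 < g t.
  move=> t0 ty; rewrite ltNge; apply/negP => gt0.
  have [a /andP[a0 at_] aE] := MVT_real dg t0.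
  have [b /andP[tb by_] bE] := MVT_real dg ty.
  have : df b < df a by apply: df_decr; [exact: ltW|exact: lt_trans tb].
  suff: df a - u / y <= 0 /\ 0 <= df b - u / y by lra.
  move: aE bE; rewrite g0 gy !subr0 sub0r => aE bE; split.
    by rewrite -(pmulr_lle0 _ t0) -aE.
  by rewrite -(pmulr_lge0 (df b - u / y) (_ : 0 < y - t)) ?subr_gt0// -bE oppr_ge0.
(* By Rolle the slope of [g] vanishes at some point of []0, y[], so it is negative beyond [y]. *)
have g_lt0 t : y < t -> g t < 0.
  move=> yt; have [a /andP[a0 ay] aE] := MVT_real dg y0.
  have [b /andP[yb bt] bE] := MVT_real dg yt.
  move: aE bE; rewrite g0 gy !subr0 => /esym/eqP.
  rewrite mulf_eq0 (gt_eqF y0) orbF => /eqP aE ->.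
  rewrite pmulr_llt0 ?subr_gt0// -aE ltrD2r df_decr ?(ltW a0)//.
  exact: lt_trans yb.
have kE m : L (y / u * m) - y / u * m ^+ 2 / 2 = k (y / u * m).
  rewrite /k; congr (_ - _); field.
  by rewrite !gt_eqF.
move=> m m0 mu; rewrite !kE divfK ?gt_eqF//.
have ym0 : 0 <= y / u * m by apply: mulr_ge0 => //; apply: divr_ge0; exact: ltW.
have [ty|ty|ty] := ltgtP (y / u * m) y.
- have [c /andP[tc cy] cE] := MVT_real dk ty.
  rewrite -subr_gt0 cE; apply: mulr_gt0; last by rewrite subr_gt0.
  by apply: g_gt0 => //; exact: le_lt_trans ym0 tc.
- have [c /andP[tc cy] cE] := MVT_real dk ty.
  by rewrite -subr_lt0 cE pmulr_llt0 ?subr_gt0//; exact: g_lt0.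
- move: mu; rewrite -(inj_eq (mulfI (_ : y / u != 0))); last first.
    by rewrite mulf_neq0// ?invr_eq0 gt_eqF.
  by rewrite ty divfK ?(gt_eqF u0)// eqxx.
Qed.

End mean_field.

(** * Densities, Gaussian laws and independence *)

Section density.
Local Open Scope ereal_scope.
Context d1 d2 (X : measurableType d1) (Y : measurableType d2) (R : realType).
Variables (mu : {measure set X -> \bar R}) (nu : {measure set Y -> \bar R}).
Variables (phi : X -> Y) (W : X -> R).
Hypothesis mphi : measurable_fun setT phi.
Hypothesis mW : measurable_fun setT W.
Hypothesis W0 : forall x, (0 <= W x)%R.
Hypothesis nuE : forall B, measurable B ->
  nu B = \int[mu]_(x in phi @^-1` B) (W x)%:E.

Import HBNNSimple.

(** The hypothesis says that [nu] is the image under [phi] of [mu] weighted by [W]; the identity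
    passes from indicators to simple functions, then by monotone convergence to [f]. It serves
    twice: with [phi] the identity for the normal density, and with [phi] a random variable and [W]
    a product of other factors for independence. *)
Lemma ge0_integral_density (f : Y -> R) :
  measurable_fun setT f -> (forall y, (0 <= f y)%R) ->
  \int[nu]_y (f y)%:E = \int[mu]_x (f (phi x) * W x)%:E.
Proof.
move=> mf f0.
have mEf : measurable_fun [set: Y] (fun y => (f y)%:E) by exact/measurable_EFinP.
have Ef0 y : setT y -> 0 <= (f y)%:E by move=> _; rewrite lee_fin.
pose f_ := nnsfun_approx measurableT mEf.
have mfphi n : measurable_fun setT (fun x => f_ n (phi x) * W x)%R.
  apply: measurable_funM => //; exact: measurableT_comp.
transitivity (limn (fun n => \int[nu]_y (f_ n y)%:E)).
  rewrite -monotone_convergence//.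
  - apply: eq_integral => y _; apply/esym/cvg_lim => //.
    exact: cvg_nnsfun_approx.
  - by move=> n; exact/measurable_EFinP.
  - by move=> n y _; rewrite lee_fin.
  - by move=> y _ m n mn; rewrite lee_fin; exact/lefP/nd_nnsfun_approx.
rewrite [X in limn X](_ : _ = (fun n => \int[mu]_x (f_ n (phi x) * W x)%:E)).
  rewrite -monotone_convergence//.
  - apply: eq_integral => x _; apply/cvg_lim => //.
    rewrite EFinM; under eq_fun do rewrite EFinM.
    by apply: cvgeZr => //; exact: cvg_nnsfun_approx.
  - by move=> n; exact/measurable_EFinP.
  - by move=> n x _; rewrite lee_fin mulr_ge0.
  - move=> x _ m n mn; rewrite lee_fin ler_wpM2r//.
    exact/lefP/nd_nnsfun_approx.
apply/funext => n.
have mpre r : measurable (phi @^-1` (f_ n @^-1` [set r])).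
  by rewrite -[X in measurable X]setTI; exact: mphi.
transitivity (\sum_(k \in range (f_ n))
    \int[mu]_x (k * \1_(phi @^-1` (f_ n @^-1` [set k])) x * W x)%:E).
  under eq_integral do rewrite fimfunE -fsumEFin//.
  rewrite ge0_integral_fsum//; last 2 first.
  - by move=> y; exact/measurable_EFinP/measurable_funM.
  - by move=> y x _; rewrite nnfun_muleindic_ge0.
  apply: eq_fsbigr => r _; rewrite integralZl_indic_nnsfun// integral_indic//=.
  rewrite setIT nuE//.
  have [r0|r0] := ltP r 0%R.
    have -> : phi @^-1` (f_ n @^-1` [set r]) = set0.
      by rewrite preimage_nnfun0// preimage_set0.
    rewrite integral_set0 mule0 integral0_eq// => x _.
    by rewrite indic0 mulr0 mul0r.
  rewrite integral_mkcond.
  under [RHS]eq_integral do rewrite -mulrA EFinM.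
  rewrite ge0_integralZl//; last 2 first.
  - by apply/measurable_EFinP/measurable_funM => //; exact: measurable_indic.
  - by move=> x _; rewrite lee_fin mulr_ge0.
  congr (_ * _); apply: eq_integral => x _.
  by rewrite patchE indicE; case: ifP; rewrite ?mul1r ?mul0r.
rewrite -ge0_integral_fsum//.
- apply: eq_integral => x _; rewrite fsumEFin//.
  by rewrite fimfunE mulr_fsuml.
- move=> r; apply/measurable_EFinP/measurable_funM => //.
  by apply: measurable_funM => //; exact: measurable_indic.
- move=> r x _; rewrite EFinM mule_ge0 ?lee_fin//.
  by have := nnfun_muleindic_ge0 (f_ n) r (phi x); rewrite lee_fin.
Qed.

End density.

(** * Translation and reflection of Lebesgue integrals *)

Section lebesgue_invariance.
Context {R : realType}.
Notation mu := (@lebesgue_measure R).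

(** Lebesgue measure is determined by its values on the intervals []a, b]], and translation
    preserves their length. Packing the translation as a measurable function makes its pushforward a
    measure, to which uniqueness applies. *)
Lemma lebesgue_measureD (c : R) (A : set R) : measurable A ->
  pushforward mu (fun x => c + x : measurableTypeR R) A = mu A.
Proof.
have mc : measurable_fun setT (fun x : measurableTypeR R => c + x : measurableTypeR R).
  exact: measurable_funD.
pose mixin := isMeasurableFun.Build _ _ _ _ _ mc.
pose phi : {mfun measurableTypeR R >-> measurableTypeR R} := HB.pack (fun x => c + x) mixin.
move=> mA; apply/esym.
apply: (@lebesgue_measure_unique _ (pushforward mu phi)) => //= _ [[a b]] _ <-.
rewrite /pushforward/=.
have -> : [eta +%R c] @^-1` `]a, b] = `]a - c, b - c]%classic.
  by apply/seteqP; split => x /=; rewrite !in_itv/= ltrBlDl lerBrDl.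
rewrite !lebesgue_measure_itv/= !lte_fin ltrD2r -!EFinB.
by have -> : b - c - (a - c) = b - a by ring.
Qed.

Lemma ge0_integral_translate (c : R) (f : R -> \bar R) :
  measurable_fun setT f -> (forall x, 0 <= f x)%E ->
  (\int[mu]_x f (c + x)%R = \int[mu]_x f x)%E.
Proof.
move=> mf f0.
have := @ge0_integral_pushforward _ _ (measurableTypeR R) (measurableTypeR R) R
  (fun x => c + x) _ mu setT f measurableT mf.
rewrite preimage_setT => <-//; last exact: measurable_funD.
by apply: eq_measure_integral => [|? A mA _];
  [exact: measurable_funD|exact: lebesgue_measureD].
Qed.

Lemma ge0_integral_reflect (f : R -> \bar R) :
  measurable_fun setT f -> (forall x, 0 <= f x)%E ->
  (\int[mu]_x f (- x)%R = \int[mu]_x f x)%E.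
Proof.
move=> mf f0.
have := @ge0_integral_pushforward _ _ (measurableTypeR R) (measurableTypeR R) R
  (fun x => - x) _ mu setT f measurableT mf.
rewrite preimage_setT => <-//; last exact: oppr_measurable.
by apply: eq_measure_integral => [|? A mA _];
  [exact: oppr_measurable|exact: lebesgue_measureN].
Qed.

End lebesgue_invariance.

Lemma bounded_integrable d (T : measurableType d) (R : realType)
    (P : probability T R) (f : T -> R) (M : R) : measurable_fun setT f ->
  (forall w, `|f w| <= M) -> P.-integrable setT (EFin \o f).
Proof.
move=> mf fM; apply: measurable_bounded_integrable => //.
  by rewrite (le_lt_trans (probability_le1 _ _))// ltry.
exists M; split; first exact: num_real.
by move=> N MN w _ /=; rewrite (le_trans (fM w))// ltW.
Qed.

Lemma integrable_weighted d (T : measurableType d) (R : realType)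
    (P : probability T R) (W X : T -> R) : measurable_fun setT W ->
  (forall w, 0 <= W w <= 1) -> P.-integrable setT (EFin \o X) ->
  P.-integrable setT (EFin \o (fun w => W w * X w)).
Proof.
move=> mW W01 iX; apply: le_integrable (iX) => //.
  apply/measurable_EFinP; apply: measurable_funM => //.
  exact/measurable_EFinP/(measurable_int _ iX).
move=> w _ /=; rewrite lee_fin normrM ler_piMl//.
by have /andP[? ?] := W01 w; rewrite ger0_norm.
Qed.

(** * Integrals against Gaussian laws *)

Section gaussian.
Context d (T : measurableType d) (R : realType) (P : probability T R).
Implicit Types (X : {RV P >-> R}) (s c : R) (f G : R -> R).
Notation mu := (@lebesgue_measure R).

Lemma ge0_integral_normal X s f :
  (forall A, measurable A -> distribution P X A = normal_prob 0 s A) ->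
  measurable_fun setT f -> (forall x, 0 <= f x) ->
  (\int[P]_w (f (X w))%:E = \int[mu]_x (f x * normal_pdf 0 s x)%:E)%E.
Proof.
move=> lawX mf f0.
have mEf : measurable_fun setT (EFin \o f) by exact/measurable_EFinP.
have mX : measurable_fun setT (X : T -> measurableTypeR R).
  by move=> mT A mA; exact: (measurable_funPT X mT A mA).
have := @ge0_integral_pushforward _ _ T (measurableTypeR R) R X mX P setT
  (EFin \o f) measurableT mEf.
rewrite preimage_setT => <-; last by move=> x _; rewrite lee_fin.
transitivity (\int[normal_prob 0 s]_y (f y)%:E)%E.
  by apply: eq_measure_integral => A mA _; exact: lawX.
rewrite (@ge0_integral_density _ _ _ _ _ mu (normal_prob 0 s) id (normal_pdf 0 s))//.
- exact: measurable_normal_pdf.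
- exact: normal_pdf_ge0.
Qed.

Lemma normal_pdfN s (x : R) : s != 0 -> normal_pdf 0 s (- x) = normal_pdf 0 s x.
Proof. by move=> s0; rewrite !normal_pdfE// /normal_fun !subr0 sqrrN. Qed.

(** Completing the square: [e^(c x)] times the standard density is [e^(c^2 / 2)] times the normal
    density centered at [c]. *)
Lemma standard_gaussian_mgf X c : is_standard_gaussian X ->
  (\int[P]_w (expR (c * X w))%:E = (expR (c ^+ 2 / 2))%:E)%E.
Proof.
move=> lawX.
rewrite (@ge0_integral_normal X 1 (fun x => expR (c * x)) lawX)//; last first.
  by apply: measurableT_comp => //; exact: measurable_funM.
rewrite (eq_integral (fun x : measurableTypeR R =>
    (expR (c ^+ 2 / 2))%:E * (normal_pdf c 1 x)%:E)%E); last first.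
  move=> x _; rewrite -EFinM !normal_pdfE ?oner_eq0//= /normal_fun.
  congr EFin; rewrite mulrCA [RHS]mulrCA -!expRD; congr (_ * expR _).
  by rewrite expr1n; field.
rewrite ge0_integralZl//.
- by rewrite integral_normal_pdf mule1.
- by apply/measurable_EFinP; exact: measurable_normal_pdf.
- by move=> x _; rewrite lee_fin normal_pdf_ge0.
Qed.

Lemma ge0_integral_normalN X s f :
  (forall A, measurable A -> distribution P X A = normal_prob 0 s A) -> s != 0 ->
  measurable_fun setT f -> (forall x, 0 <= f x) ->
  (\int[P]_w (f (- X w))%:E = \int[P]_w (f (X w))%:E)%E.
Proof.
move=> lawX s0 mf f0.
rewrite (ge0_integral_normal lawX mf f0).
have mfN : measurable_fun setT (fun x : R => f (- x)) by exact: measurableT_comp.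
rewrite (@ge0_integral_normal X s (fun x => f (- x)) lawX mfN) => [|x]; last exact: f0.
rewrite -[RHS]ge0_integral_reflect.
- by apply: eq_integral => x _; rewrite normal_pdfN.
- apply/measurable_EFinP; apply: measurable_funM => //; exact: measurable_normal_pdf.
- by move=> x; rewrite lee_fin mulr_ge0// normal_pdf_ge0.
Qed.

(** The integral is the difference of the integrals of the positive and negative parts, and each
    part is covered by the symmetry for nonnegative functions. *)
Lemma integral_symmetric X f : measurable_fun setT f ->
  (forall k : R -> R, measurable_fun setT k -> (forall x, 0 <= k x) ->
    (\int[P]_w (k (- X w))%:E = \int[P]_w (k (X w))%:E)%E) ->
  (\int[P]_w (f (- X w))%:E = \int[P]_w (f (X w))%:E)%E.
Proof.
move=> mf sym.
have max0 (k : R -> R) w : 0 <= Num.max (k w) 0 by rewrite le_max lexx orbT.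
rewrite integralE [RHS]integralE; congr (_ - _)%E.
  under eq_integral do rewrite funeposE -EFin_max.
  under [RHS]eq_integral do rewrite funeposE -EFin_max.
  exact: (sym (fun x => Num.max (f x) 0) (measurable_funrpos mf)).
under eq_integral do rewrite funenegE -EFinN -EFin_max.
under [RHS]eq_integral do rewrite funenegE -EFinN -EFin_max.
exact: (sym (fun x => Num.max (- f x) 0) (measurable_funrneg mf)).
Qed.

Lemma integral_dirac_law X f : measurable_fun setT f ->
  (forall A, measurable A -> distribution P X A = \d_(0 : R) A) ->
  (\int[P]_w (f (X w))%:E = (f 0)%:E)%E.
Proof.
move=> mf lawX.
have X0 : {ae P, forall w, setT w -> (f (X w))%:E = (f 0)%:E}.
  exists (X @^-1` [set~ 0]); split.
  - by apply: measurable_funPTI; exact: measurableC.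
  - have := lawX [set~ 0]; rewrite /distribution /pushforward => ->.
      by rewrite diracE memNset// => /(_ erefl).
    exact: measurableC.
  - by move=> w /= Xw X0; apply: Xw => _; rewrite X0.
rewrite (ae_eq_integral (cst (f 0)%:E))//.
- by have := expectation_cst P (f 0); rewrite unlock => ->.
- by apply/measurable_EFinP; exact: measurableT_comp.
Qed.

Lemma centered_gaussian_symmetric X f : is_centered_gaussian X ->
  measurable_fun setT f ->
  (\int[P]_w (f (- X w))%:E = \int[P]_w (f (X w))%:E)%E.
Proof.
move=> [s _ lawX] mf; have [s0|s0] := eqVneq s 0.
  have lawX0 A : measurable A -> distribution P X A = \d_(0 : R) A.
    by move=> mA; rewrite lawX// /centered_gaussian_law s0 eqxx.
  have mfN : measurable_fun setT (fun x : R => f (- x)) by exact: measurableT_comp.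
  by rewrite (integral_dirac_law mf lawX0) (integral_dirac_law mfN lawX0) oppr0.
apply: integral_symmetric => // k mk k0.
apply: (ge0_integral_normalN _ s0) => // A mA.
by rewrite lawX// /centered_gaussian_law (negbTE s0).
Qed.

(* Writing [G^+] for the positive part, oddness and symmetry turn the integral
   into [\int G^+(z) (p (z - c) - p (z + c)) dz], where the Gaussian density [p]
   gives more mass to [z - c] than to [z + c] when [z > 0]. *)
Lemma gaussian_odd_gt0 X G c : is_centered_gaussian X -> 0 < c ->
  continuous G -> (forall x, G (- x) = - G x) -> (forall x, `|G x| <= 1) ->
  (forall x, 0 < x -> 0 < G x) ->
  0 < \int[P]_w G (c + X w).
Proof.
move=> gX c0 cG oddG G1 Gpos.
have mG : measurable_fun setT G by exact: continuous_measurable_fun.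
(* In the degenerate case [X] is almost surely 0 and the integral is [G c]. *)
case: (gX) => s s_ge0 lawX; have [s0|s0] := eqVneq s 0.
  have lawX0 A : measurable A -> distribution P X A = \d_(0 : R) A.
    by move=> mA; rewrite lawX// /centered_gaussian_law s0 eqxx.
  rewrite /Rintegral (@integral_dirac_law X (fun x : R => G (c + x)))//.
    by rewrite addr0; exact: Gpos.
  by apply: measurableT_comp => //; exact: measurable_funD.
have {}lawX A : measurable A -> distribution P X A = normal_prob 0 s A.
  by move=> mA; rewrite lawX// /centered_gaussian_law (negbTE s0).
pose Gp x := Num.max (G x) 0.
have mGp : measurable_fun setT Gp by exact: measurable_maxr.
have Gp0 x : 0 <= Gp x by rewrite le_max lexx orbT.
have Gp1 x : Gp x <= 1.
  by rewrite ge_max ler01 andbT (le_trans (ler_norm _)).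
have GE x : G x = Gp x - Gp (- x).
  rewrite /Gp oddG; have [G0|G0] := leP (G x) 0.
    by rewrite max_l ?oppr_ge0// sub0r opprK.
  by rewrite max_r ?subr0// oppr_le0 ltW.
have Gp_np x : x <= 0 -> Gp x = 0.
  rewrite /Gp -oppr_ge0 le_eqVlt => /predU1P[x0|x0].
    have -> : x = 0 by lra.
    have G0 : G 0 = 0 by have := oddG 0; rewrite oppr0; lra.
    by rewrite G0 maxxx.
  by rewrite max_r// -oppr_ge0 -oddG ltW// Gpos.
have intGp e : (\int[P]_w (Gp (e + X w))%:E =
    \int[mu]_x (Gp x * normal_pdf 0 s (x - e))%:E)%E.
  have mGe : measurable_fun setT (fun x => Gp (e + x)).
    by apply: measurableT_comp => //; exact: measurable_funD.
  rewrite (ge0_integral_normal lawX mGe (fun x => Gp0 _)).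
  rewrite -[RHS](ge0_integral_translate e).
  - by apply: eq_integral => x _; rewrite addrAC subrr add0r.
  - apply/measurable_EFinP/measurable_funM => //.
    apply: measurableT_comp; first exact: measurable_normal_pdf.
    exact: measurable_funD.
  - by move=> x; rewrite lee_fin mulr_ge0// normal_pdf_ge0.
pose K e (x : R) := Gp x * normal_pdf 0 s (x - e).
have mK e : measurable_fun setT (K e).
  apply: measurable_funM => //.
  apply: measurableT_comp; first exact: measurable_normal_pdf.
  exact: measurable_funD.
have K0 e x : 0 <= K e x by rewrite mulr_ge0// normal_pdf_ge0.
have mGpX e : measurable_fun setT (fun w => Gp (e + X w)).
  by apply: measurableT_comp => //; exact: measurable_funD.
have iGp e : P.-integrable setT (EFin \o (fun w => Gp (e + X w))).
  by apply: (@bounded_integrable _ _ _ _ _ 1) => // w; rewrite ger0_norm.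
have iGpN : P.-integrable setT (EFin \o (fun w => Gp (- (c + X w)))).
  apply: (@bounded_integrable _ _ _ _ _ 1) => [|w]; last by rewrite ger0_norm.
  by apply: measurableT_comp => //; apply: measurableT_comp => //; exact: measurable_funD.
have iK e : mu.-integrable setT (EFin \o K e).
  apply/integrableP; split; first by apply/measurable_EFinP; exact: mK.
  under eq_integral => x _ do (simpl; rewrite (ger0_norm (K0 e x))).
  rewrite /K -intGp; move/integrableP : (iGp e) => [_].
  by under eq_integral => x _ do (simpl; rewrite (ger0_norm (Gp0 _))).
(* [- (c + X)] has the law of [- c + X], so the negative part of [G] also takes the form
   [Gp (e + X)], with [e = - c], and [intGp] applies to it. *)
have GpN : (\int[P]_w (Gp (- (c + X w)))%:E = \int[P]_w (Gp (- c + X w))%:E)%E.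
  under eq_integral do rewrite opprD.
  apply: (@centered_gaussian_symmetric X (fun x => Gp (- c + x)) gX).
  by apply: measurableT_comp => //; exact: measurable_funD.
have -> : \int[P]_w G (c + X w) = \int[mu]_x (K c x - K (- c) x).
  under eq_Rintegral do rewrite GE.
  rewrite RintegralB// /Rintegral GpN !intGp -fineB.
  - by congr fine; exact: (esym (integralB_EFin measurableT (iK c) (iK (- c)))).
  - by have := integrable_fin_num measurableT (iK c).
  - by have := integrable_fin_num measurableT (iK (- c)).
pose D x := K c x - K (- c) x.
have D_gt0 x : 0 < x -> 0 < D x.
  move=> x0; rewrite /D /K -mulrBr mulr_gt0//.
    by rewrite /Gp lt_max Gpos.
  rewrite subr_gt0 !normal_pdfE// ltr_pM2l ?normal_peak_gt0//.
  rewrite /normal_fun ltr_expR !subr0 ltr_pM2r ?invr_gt0 ?pmulrn_lgt0 ?exprn_even_gt0//.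
  by rewrite ltrN2; nra.
have D0 x : 0 <= D x.
  have [x0|x0] := leP x 0; last exact/ltW/D_gt0.
  by rewrite /D /K Gp_np// !mul0r subrr.
(* Strictness: a zero integral would force [D = 0] almost everywhere, while [D] is positive on []0,
   1[], which has measure 1. *)
rewrite lt_neqAle Rintegral_ge0 ?andbT//; last by move=> x _; exact: D0.
apply/negP => /eqP intD0.
have iD : mu.-integrable setT (EFin \o D).
  exact: (integrableB measurableT (iK c) (iK (- c))).
have : ae_eq mu setT (EFin \o D) (cst 0%E).
  apply/(ae_eq_integral_abs mu measurableT); first exact: measurable_int iD.
  under eq_integral => x _ do (simpl; rewrite (ger0_norm (D0 x))).
  apply/eqP; rewrite -fine_eq0; first by rewrite -[X in X == _]intD0.
  exact: integrable_fin_num iD.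
move=> [N [mN N0 DN]].
have : (mu `]0%R, 1%R[ <= mu N)%E.
  apply: le_measure; rewrite ?inE//; apply: subset_trans DN => x /=.
  rewrite in_itv/= => /andP[x0 _] /(_ Logic.I) [] Dx.
  by have := D_gt0 x x0; rewrite Dx ltxx.
by rewrite N0 lebesgue_measure_itv/= lte01 sube0 leNgt lte01.
Qed.

End gaussian.

(** * Expectation of a product of independent factors *)

Section independence.
Context d (T : measurableType d) (R : realType) (P : probability T R).
Context (I : choiceType) (D : set I) (X : I -> {RV P >-> R}).
Hypothesis indep : mutually_independent D X.
Local Open Scope ereal_scope.

Lemma prode_fin_num (s : seq I) (F : I -> \bar R) :
  (forall i, 0 <= F i) -> (forall i, i \in s -> F i < +oo) ->
  \prod_(i <- s) F i = (\prod_(i <- s) fine (F i))%:E.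
Proof.
move=> F0; elim: s => [|x s IH] Fs; first by rewrite !big_nil.
rewrite !big_cons EFinM IH => [|i si]; last by rewrite Fs// inE si orbT.
by rewrite fineK// ge0_fin_numE// Fs// mem_head.
Qed.

(* Moving an index from [s1] to [s2] replaces its function by an indicator; as both
   sides are measures in the set [B i], they then agree on all nonnegative functions. *)
Let independent_prod_indic (s1 s2 : seq I) (f : I -> R -> R) (B : I -> set R) :
  uniq (s1 ++ s2) -> [set` s1 ++ s2] `<=` D ->
  (forall i, measurable_fun setT (f i)) -> (forall i x, (0 <= f i x)%R) ->
  (forall i, i \in s1 -> \int[P]_w (f i (X i w))%:E < +oo) ->
  (forall i, measurable (B i)) ->
  \int[P]_w ((\prod_(i <- s1) f i (X i w)) * \prod_(i <- s2) \1_(B i) (X i w))%R%:E =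
  (\prod_(i <- s1) \int[P]_w (f i (X i w))%:E) * \prod_(i <- s2) P (X i @^-1` B i).
Proof.
move=> + + mf f0 + +; elim: s1 s2 B => [|x s1 IH] s2 B us sD fy mB.
  have indicE' w : (\prod_(i <- s2) \1_(B i) (X i w) =
      \1_(\bigcap_(i in [set` s2]) (X i @^-1` B i)) w)%R.
    rewrite bigcap_seq; elim: s2 {us sD} => [|i s2 IH].
      by rewrite !big_nil indicE in_setT.
    by rewrite !big_cons IH !indicE in_setI -natrM mulnb; congr (_ && _)%:R.
  under eq_integral do rewrite big_nil mul1r indicE'.
  rewrite big_nil mul1e -indep// -expectation_indic ?unlock//.
  rewrite bigcap_seq; apply: bigsetI_measurable => i _; exact: measurable_funPTI.
have {}fy1 i : i \in s1 -> \int[P]_w (f i (X i w))%:E < +oo.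
  by move=> si; rewrite fy// inE si orbT.
pose W w := ((\prod_(i <- s1) f i (X i w)) * \prod_(i <- s2) \1_(B i) (X i w))%R.
have mfX i : measurable_fun setT (fun w => f i (X i w)) by exact: measurableT_comp.
have mW : measurable_fun setT W.
  apply: measurable_funM; first exact: measurable_prod.
  apply: measurable_prod => i _.
  have m1 : measurable_fun setT (\1_(B i) : R -> R) by exact: measurable_indic.
  exact: measurableT_comp.
have W0 w : (0 <= W w)%R by rewrite mulr_ge0// prodr_ge0.
have int0 i : 0 <= \int[P]_w (f i (X i w))%:E.
  by apply: integral_ge0 => w _; rewrite lee_fin.
set c := (\prod_(i <- s1) \int[P]_w (f i (X i w))%:E) *
  \prod_(i <- s2) P (X i @^-1` B i).
(* The constant [c] must be a finite nonnegative real to serve as the scale of a measure. *)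
have [r r0 cE] : exists2 r : R, (0 <= r)%R & c = r%:E.
  rewrite /c !prode_fin_num//.
    by eexists; last exact: EFinM; rewrite mulr_ge0// prodr_ge0// => i _; rewrite fine_ge0.
  by move=> i _; rewrite (le_lt_trans (probability_le1 _ _)) ?ltry//; exact: measurable_funPTI.
(* The image under [X x] of [P] weighted by [W] is [c] times the law of [X x]. On a set [A] this is
   the induction hypothesis with [x] moved to the indicator side and [B x] replaced by [A]; the
   other sets are unaffected because [x] occurs nowhere else. *)
have nuE A : measurable A ->
    mscale (NngNum r0) (distribution P (X x)) A = \int[P]_(w in X x @^-1` A) (W w)%:E.
  move=> mA; pose B' i := if i == x then A else B i.
  have xs : x \notin s1 ++ s2 by move: us => /= /andP[].
  have B'E i : i \in s2 -> B' i = B i.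
    move=> si; rewrite /B'; case: eqP => // ix.
    by move: xs; rewrite mem_cat -ix si orbT.
  have B'x : B' x = A by rewrite /B' eqxx.
  have us' : uniq (s1 ++ x :: s2).
    by rewrite (perm_uniq (permEl (perm_catCA s1 [:: x] s2))).
  have sD' : [set` s1 ++ x :: s2] `<=` D.
    apply: subset_trans sD => i /=.
    by rewrite (perm_mem (permEl (perm_catCA s1 [:: x] s2))).
  have mB' i : measurable (B' i) by rewrite /B'; case: ifP.
  transitivity (\int[P]_w ((\prod_(i <- s1) f i (X i w)) *
      \prod_(i <- x :: s2) \1_(B' i) (X i w))%R%:E).
    rewrite IH// big_cons B'x muleCA /mscale/= muleC.
    rewrite [X in _ = _ * (_ * X)](_ : _ = \prod_(j <- s2) P (X j @^-1` B j)).
      by rewrite -/c cE.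
    by apply: eq_big_seq => i si; rewrite B'E.
  rewrite [RHS]integral_mkcond; apply: eq_integral => w _.
  rewrite patchE big_cons B'x mulrCA indicE; case: ifPn => wA.
    rewrite (_ : X x w \in A) ?mul1r; last by move: wA; rewrite !inE.
    by congr (_ * _)%:E; apply: eq_big_seq => i si; rewrite B'E.
  by rewrite (negbTE (_ : X x w \notin A)) ?mul0r//; move: wA; rewrite !notin_setE.
rewrite !big_cons.
under eq_integral do rewrite big_cons -mulrA.
rewrite -(@ge0_integral_density _ _ _ _ _ P _ (X x) W _ mW W0 nuE (f x))//.
have mfx : measurable_fun setT (EFin \o f x) by exact/measurable_EFinP.
have fx0 t : 0 <= (EFin \o f x) t by rewrite lee_fin.
rewrite (ge0_integral_mscale _ measurableT _ mfx (fun t _ => fx0 t))/=.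
by rewrite (ge0_integral_distribution _ mfx fx0)/= -cE /c muleC muleA.
Qed.

Lemma independent_prod (s : seq I) (f : I -> R -> R) :
  uniq s -> [set` s] `<=` D ->
  (forall i, measurable_fun setT (f i)) -> (forall i x, (0 <= f i x)%R) ->
  (forall i, i \in s -> \int[P]_w (f i (X i w))%:E < +oo) ->
  \int[P]_w (\prod_(i <- s) f i (X i w))%R%:E =
  \prod_(i <- s) \int[P]_w (f i (X i w))%:E.
Proof.
move=> us sD mf f0 fy.
have := @independent_prod_indic s [::] f (fun=> setT).
rewrite cats0 big_nil mule1 => <-//.
by apply: eq_integral => w _; rewrite big_nil mulr1.
Qed.

End independence.

(** * The Hamiltonian as a linear form in the couplings *)

Section words.
Context {R : realType}.
Variables (N : nat) (bs : nat -> R).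

(** The parameter is half the length: these are the words of length [2 p] that index the [p]-th term
    of the Hamiltonian. *)
Definition words_of_size (p : nat) : seq (seq nat) :=
  [seq [seq val i | i <- tval t] | t <- enum {: (2 * p).-tuple 'I_N}].

Definition words (n : nat) : seq (seq nat) :=
  flatten [seq words_of_size p | p <- index_iota 1 n].

Lemma size_words_of_size p k : k \in words_of_size p -> size k = (2 * p)%N.
Proof. by case/mapP => t _ ->; rewrite size_map size_tuple. Qed.

Lemma uniq_words_of_size p : uniq (words_of_size p).
Proof.
rewrite map_inj_uniq ?enum_uniq// => s t.
by move/(inj_map val_inj)/val_inj.
Qed.

(** Distinct [p] give words of distinct lengths. Absence of repetition is what independence requires
    of a list of indices. *)
Lemma uniq_words n : uniq (words n).
Proof.
have : uniq (index_iota 1 n) by exact: iota_uniq.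
rewrite /words; elim: (index_iota 1 n) => //= p ps IH /andP[pps ups].
rewrite cat_uniq uniq_words_of_size IH// andbT.
apply/hasPn => k /flatten_mapP[q qps kq]; apply/negP => kp.
move: pps; suff -> : p = q by rewrite qps.
move: (size_words_of_size kp); rewrite (size_words_of_size kq) => /eqP.
by rewrite eqn_pmul2l// => /eqP.
Qed.

Lemma coupling_words n k : k \in words n -> coupling_word k.
Proof.
case/flatten_mapP => p; rewrite mem_index_iota => /andP[p0 _] /size_words_of_size kp.
by rewrite /coupling_word kp oddM/= muln_gt0 p0.
Qed.

Lemma sum_words (F : seq nat -> R) n :
  \sum_(k <- words n) F k =
  \sum_(1 <= p < n) \sum_(t : (2 * p).-tuple 'I_N) F [seq val i | i <- t].
Proof.
rewrite big_flatten big_map; apply: eq_bigr => p _.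
by rewrite big_map big_enum.
Qed.

(* The value 1 for [j >= N] is never used. *)
Definition site_spin (sigma : {ffun 'I_N -> bool}) (j : nat) : R :=
  if insub j is Some i then spin R sigma i else 1.

(** The coefficient of [g k] in the Hamiltonian. Reading [p] off the length of the word turns the
    double sum over [p] and tuples into one sum over words. *)
Definition coef (sigma : {ffun 'I_N -> bool}) (k : seq nat) : R :=
  bs (size k)./2 / N%:R `^ ((size k)./2%:R - 2^-1) * \prod_(j <- k) site_spin sigma j.

Lemma site_spin_val sigma (i : 'I_N) : site_spin sigma i = spin R sigma i.
Proof. by rewrite /site_spin valK. Qed.

Lemma coefE sigma p (t : (2 * p).-tuple 'I_N) :
  coef sigma [seq val i | i <- t] =
  bs p / N%:R `^ (p%:R - 2^-1) * \prod_(i <- t) spin R sigma i.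
Proof.
have sz : (size [seq val i | i <- t])./2 = p.
  by rewrite size_map size_tuple mul2n doubleK.
rewrite /coef sz big_map; congr (_ * _).
by apply: eq_bigr => i _; rewrite site_spin_val.
Qed.

Lemma spin_sqr sigma (i : 'I_N) : spin R sigma i ^+ 2 = 1.
Proof. by rewrite /spin; case: ifP => _; rewrite ?sqrrN expr1n. Qed.

(** There are [N^(2p)] words, each with squared coefficient [bs p ^+ 2 / N^(2p - 1)]. The sum is the
    variance of the [p]-th term of the Hamiltonian, whence the total [N xi(1)]. *)
Lemma sum_coef_sqr sigma p : (0 < N)%N ->
  \sum_(t : (2 * p).-tuple 'I_N) coef sigma [seq val i | i <- t] ^+ 2 =
  N%:R * bs p ^+ 2.
Proof.
move=> N0; have NR : (0 : R) < N%:R by rewrite ltr0n.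
rewrite (eq_bigr (fun=> (bs p / N%:R `^ (p%:R - 2^-1)) ^+ 2)); last first.
  move=> t _; rewrite coefE exprMn -prodrXl.
  by rewrite big1 ?mulr1// => i _; rewrite spin_sqr.
rewrite sumr_const card_tuple card_ord -[LHS]mulr_natl natrX.
set q := N%:R `^ (p%:R - 2^-1).
have q0 : q != 0 by rewrite gt_eqF// powR_gt0.
have <- : N%:R * q ^+ 2 = N%:R ^+ (2 * p) :> R.
  rewrite -[in LHS](@powR_mulrn _ q 2) ?powR_ge0// -powRrM.
  rewrite -{1}[N%:R](powRr1 (ltW NR)) -powRD ?(gt_eqF NR) ?implybT//.
  by rewrite -powR_mulrn ?(ltW NR)// natrM; congr (_ `^ _); field.
by field.
Qed.

End words.

(** An arbitrary product of functions of the local fields, later the Gibbs weight of a configuration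
    under the fields alone. What matters for now is its independence of the couplings. *)
Definition field_weight d (T : measurableType d) (R : realType)
    (P : probability T R) (hs : nat -> {RV P >-> R}) (N : nat)
    (phi : nat -> R -> R) (w : T) : R :=
  \prod_(i < N) phi i (hs i w).

(** * Joint expectations over fields and couplings *)

Section disorder_products.
Context d (T : measurableType d) (R : realType) (P : probability T R).
Variables (h : {RV P >-> R}) (g : seq nat -> {RV P >-> R}) (hs : nat -> {RV P >-> R}).
Hypothesis dis : is_disorder h g hs.
Variables (N : nat) (phi : nat -> R -> R).
Hypothesis mphi : forall i, measurable_fun setT (phi i).
Hypothesis phi01 : forall i y, 0 <= phi i y <= 1.

Let phi0 i y : 0 <= phi i y. Proof. by have /andP[] := phi01 i y. Qed.

Notation weight := (field_weight hs N phi).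

Let phi_fin i : (\int[P]_w (phi i (hs i w))%:E < +oo)%E.
Proof.
have iphi : P.-integrable setT (EFin \o (fun w => phi i (hs i w))).
  apply: (@bounded_integrable _ _ _ _ _ 1) => [|w]; first exact: measurableT_comp.
  by have /andP[? ?] := phi01 i (hs i w); rewrite ger0_norm.
have /fin_numPlt/andP[_ //] := integrable_fin_num measurableT iphi.
Qed.

(** Fields and couplings form a single independent family indexed by a sum type, so the expectation
    splits over all indices at once. *)
Lemma disorder_prod (s : seq (seq nat)) (gam : seq nat -> R -> R) :
  uniq s -> (forall k, k \in s -> coupling_word k) ->
  (forall k, measurable_fun setT (gam k)) -> (forall k y, 0 <= gam k y) ->
  (forall k, k \in s -> (\int[P]_w (gam k (g k w))%:E < +oo)%E) ->
  (\int[P]_w (weight w * \prod_(k <- s) gam k (g k w))%:E =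
   \int[P]_w (weight w)%:E * \prod_(k <- s) \int[P]_w (gam k (g k w))%:E)%E.
Proof.
move=> us cs mgam gam0 gam_fin; have [indep _ _] := dis.
pose f (k : seq nat + nat) := match k with inl w => gam w | inr i => phi i end.
pose key (s : seq (seq nat)) : seq (seq nat + nat) :=
  map inr (index_iota 0 N) ++ map inl s.
have keyP s' : uniq s' -> (forall k, k \in s' -> coupling_word k) ->
    (forall k, k \in s' -> (\int[P]_w (gam k (g k w))%:E < +oo)%E) ->
    (\int[P]_w (weight w * \prod_(k <- s') gam k (g k w))%:E =
    (\prod_(i <- index_iota 0 N) \int[P]_w (phi i (hs i w))%:E) *
    \prod_(k <- s') \int[P]_w (gam k (g k w))%:E)%E.
  move=> us' cs' fs'.
  have := @independent_prod _ _ _ _ _ _ _ indep (key s') f.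
  rewrite big_cat !big_map/= => <-.
  - apply: eq_integral => w _; rewrite big_cat !big_map/=.
    by rewrite /field_weight -(big_mkord xpredT (fun i => phi i (hs i w))).
  - rewrite cat_uniq !map_inj_uniq ?iota_uniq ?us'//; last 2 first.
    + by move=> ? ? [].
    + by move=> ? ? [].
    by rewrite andbT; apply/hasPn => _ /mapP[k _ ->]; apply/mapP => -[].
  - move=> k /=; rewrite mem_cat => /orP[] /mapP[i is' ->] //=.
    exact: cs'.
  - by case.
  - by case.
  - move=> k; rewrite mem_cat => /orP[] /mapP[i is' ->] //=.
    exact: fs'.
rewrite keyP//; congr (_ * _)%E.
(* The empty list of words reassembles the product of the field integrals into the integral of the
   weight. *)
have := keyP [::] isT; rewrite !big_nil mule1 => <-//.
by apply: eq_integral => w _; rewrite big_nil mulr1.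
Qed.

Lemma disorder_mgf (s : seq (seq nat)) (a : seq nat -> R) :
  uniq s -> (forall k, k \in s -> coupling_word k) ->
  (\int[P]_w (weight w * expR (\sum_(k <- s) a k * g k w))%:E =
   \int[P]_w (weight w)%:E * (expR ((\sum_(k <- s) a k ^+ 2) / 2))%:E)%E.
Proof.
move=> us cs; have [_ gN _] := dis.
have mgfE k : k \in s ->
    (\int[P]_w (expR (a k * g k w))%:E = (expR (a k ^+ 2 / 2))%:E)%E.
  by move=> ks; apply/standard_gaussian_mgf/gN/cs.
under eq_integral do rewrite expR_sum.
rewrite (@disorder_prod s (fun k y => expR (a k * y)))//.
- congr (_ * _)%E; rewrite mulr_suml expR_sum.
  rewrite (eq_big_seq (fun k => (expR (a k ^+ 2 / 2))%:E))//.
  by elim/big_rec2: _ => // k x y _ ->.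
- by move=> k; apply: measurableT_comp => //; exact: measurable_funM.
- by move=> k ks; rewrite mgfE// ltry.
Qed.

Lemma standard_gaussian_integrable k : coupling_word k ->
  P.-integrable setT (EFin \o g k).
Proof.
move=> ck; have [_ gN _] := dis; apply/integrableP; split; first exact/measurable_EFinP.
(* The bound [|y| <= e^y + e^(-y)] reduces integrability to two known exponential moments. *)
apply: (@le_lt_trans _ _ (\int[P]_w (expR (1 * g k w) + expR (-1 * g k w))%:E)%E).
  apply: ge0_le_integral => //.
  - by apply: measurableT_comp => //; exact/measurable_EFinP.
  - apply/measurable_EFinP; apply: measurable_funD; apply: measurableT_comp => //;
      exact: measurable_funM.
  - move=> w _ /=; rewrite lee_fin mul1r mulN1r ler_norml.
    have := expR_ge1Dx (g k w); have := expR_ge1Dx (- g k w).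
    by have := expR_gt0 (g k w); have := expR_gt0 (- g k w); lra.
under eq_integral do rewrite EFinD.
rewrite ge0_integralD//.
- by rewrite !(standard_gaussian_mgf _ (gN _ ck)) -EFinD ltry.
- by apply/measurable_EFinP; apply: measurableT_comp => //; exact: measurable_funM.
- by apply/measurable_EFinP; apply: measurableT_comp => //; exact: measurable_funM.
Qed.

Lemma field_weight01 w : 0 <= weight w <= 1.
Proof.
by rewrite prodr_ge0//= prodr_ile1.
Qed.

Lemma measurable_field_weight : measurable_fun setT weight.
Proof. by apply: measurable_prod => i _; exact: measurableT_comp. Qed.

(** The product formula is stated for nonnegative functions, so [g k] is split into its positive and
    negative parts, whose integrals agree by symmetry of the Gaussian law. *)
Lemma disorder_centered k : coupling_word k ->
  \int[P]_w (weight w * g k w) = 0.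
Proof.
move=> ck; have [_ gN _] := dis.
pose pos (y : R) := Num.max y 0; pose neg (y : R) := Num.max (- y) 0.
have mpos : measurable_fun setT pos by exact: measurable_maxr.
have mneg : measurable_fun setT neg by apply: measurable_maxr => //; exact: oppr_measurable.
have pos0 y : 0 <= pos y by rewrite le_max lexx orbT.
have neg0 y : 0 <= neg y by rewrite le_max lexx orbT.
have posE y : y = pos y - neg y.
  rewrite /pos /neg; case/orP: (le_total y 0) => y0.
    by rewrite (max_r y0) max_l ?oppr_ge0//; lra.
  by rewrite (max_l y0) max_r ?oppr_le0//; lra.
have pos_norm y : pos y <= `|y| by rewrite ge_max ler_norm normr_ge0.
have neg_norm y : neg y <= `|y| by rewrite ge_max -normrN ler_norm normr_ge0.
have bound (c : R -> R) : measurable_fun setT c -> (forall y, 0 <= c y) ->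
    (forall y, c y <= `|y|) ->
    [/\ P.-integrable setT (EFin \o (fun w => c (g k w))),
      P.-integrable setT (EFin \o (fun w => weight w * c (g k w))) &
    (\int[P]_w (weight w * c (g k w))%:E =
     \int[P]_w (weight w)%:E * \int[P]_w (c (g k w))%:E)%E].
  move=> mc c0 c_norm.
  have mcg : measurable_fun setT (fun w => c (g k w)) by exact: measurableT_comp.
  have ic : P.-integrable setT (EFin \o (fun w => c (g k w))).
    apply: le_integrable (standard_gaussian_integrable ck) => //.
      exact/measurable_EFinP.
    by move=> w _ /=; rewrite lee_fin (ger0_norm (c0 _)).
  split => //.
    exact: (integrable_weighted measurable_field_weight field_weight01 ic).
  have := @disorder_prod [:: k] (fun=> c) isT.
  rewrite big_seq1 => <-//.
  - by apply: eq_integral => w _; rewrite big_seq1.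
  - by move=> k'; rewrite inE => /eqP ->.
  - move=> k'; rewrite inE => /eqP ->.
    by have /fin_numPlt/andP[] := integrable_fin_num measurableT ic.
have [ip iWp Ep] := bound _ mpos pos0 pos_norm.
have [in_ iWn En] := bound _ mneg neg0 neg_norm.
have symE : (\int[P]_w (neg (g k w))%:E = \int[P]_w (pos (g k w))%:E)%E.
  exact: (ge0_integral_normalN (gN _ ck) (oner_neq0 R) mpos pos0).
under eq_Rintegral do rewrite [X in _ * X]posE mulrBr.
by rewrite RintegralB// /Rintegral Ep En symE subrr.
Qed.

End disorder_products.

(** * The random Hamiltonian and the free energy *)

Section limits.
Context d (T : measurableType d) (R : realType).

(** Convergence is expressed through the lower and upper limits because these are measurable in a
    parameter, which makes the set of convergence measurable. *)
Lemma cvgn_limn_einf_esup (u : R^nat) :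
  cvgn u <-> limn_einf (EFin \o u) = limn_esup (EFin \o u) /\
             limn_esup (EFin \o u) \is a fin_num.
Proof.
split=> [/cvg_ex[/= l ul]|[eqlim lfin]].
  have ul' : (EFin \o u) n @[n --> \oo] --> l%:E.
    by apply: cvg_EFin => //; exact: nearW.
  by have [-> ->] := cvg_limn_einf_sup ul'.
apply/cvg_ex; exists (fine (limn_esup (EFin \o u))).
have : (EFin \o u) n @[n --> \oo] --> limn_esup (EFin \o u).
  apply: (@squeeze_cvge _ _ _ _ (einfs (EFin \o u)) _ (esups (EFin \o u))).
  - apply: nearW => n; apply/andP; split.
      by apply: ereal_inf_lbound; exists n => //=.
    by apply: ereal_sup_ubound; exists n => //=.
  - by rewrite -eqlim limn_einf_lim; exact: is_cvg_einfs.
  - by rewrite limn_esup_lim; exact: is_cvg_esups.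
rewrite -{1}(fineK lfin) => cvgu; exact: (fine_cvg cvgu).
Qed.

Lemma measurable_limn_einf (F : (T -> \bar R)^nat) :
  (forall n, measurable_fun setT (F n)) ->
  measurable_fun setT (fun w => limn_einf (F ^~ w)).
Proof.
move=> mF; have mNF n : measurable_fun setT (fun w => - F n w)%E by exact: measurableT_comp.
have -> : (fun w => limn_einf (F ^~ w)) = (fun w => - limn_esup (fun n => - F n w))%E.
  apply/funext => w; rewrite -limn_einfN; congr limn_einf; apply/funext => n.
  exact: (esym (oppeK _)).
by apply: measurableT_comp => //; exact: measurable_fun_limn_esup.
Qed.

Lemma measurable_cvgn (f : (T -> R)^nat) :
  (forall n, measurable_fun setT (f n)) -> measurable [set w | cvgn (f ^~ w)].
Proof.
move=> mf; pose F n w := (f n w)%:E.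
have mF n : measurable_fun setT (F n) by exact/measurable_EFinP.
have mesup : measurable_fun setT (fun w => limn_esup (F ^~ w)).
  exact: measurable_fun_limn_esup.
have meinf : measurable_fun setT (fun w => limn_einf (F ^~ w)).
  exact: measurable_limn_einf.
have -> : [set w | cvgn (f ^~ w)] =
    (setT `&` [set w | limn_einf (F ^~ w) = limn_esup (F ^~ w)]) `&`
    (setT `&` [set w | limn_esup (F ^~ w) \is a fin_num]).
  apply/seteqP; split => w /=.
    by move/cvgn_limn_einf_esup => [].
  by move=> [[_ ?] [_ ?]]; apply/cvgn_limn_einf_esup.
apply: measurableI; first exact: measurable_eqe.
exact: emeasurable_fin_num.
Qed.

(* [limn] is the constant [point] on the set where the sequence diverges. *)
Lemma measurable_limn (f : (T -> R)^nat) :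
  (forall n, measurable_fun setT (f n)) ->
  measurable_fun setT (fun w => limn (f ^~ w)).
Proof.
move=> mf; have mC := measurable_cvgn mf.
rewrite -(setUv [set w | cvgn (f ^~ w)]); apply/measurable_funU => //.
  exact: measurableC.
split.
  apply: (@measurable_fun_cvg _ _ _ _ f) => [m|w //].
  exact: measurable_funTS.
apply: (eq_measurable_fun (cst point)) => // w; rewrite inE => nC.
by rewrite dvgP.
Qed.

End limits.

(** * Random series with summable first absolute moments *)

Definition partial_sum (R : realType) T (X : nat -> T -> R) (n : nat) (w : T) : R :=
  \sum_(1 <= p < n) X p w.

Section random_series.
Context d (T : measurableType d) (R : realType) (P : probability T R).
Variables (X : nat -> T -> R) (c : nat -> R).
Hypothesis mX : forall p, measurable_fun setT (X p).
Hypothesis Xc : forall p, (0 < p)%N -> (\int[P]_w `|X p w|%:E <= (c p)%:E)%E.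
Hypothesis c_sum : (\sum_(1 <= p <oo) (c p)%:E < +oo)%E.

Notation S := (partial_sum X).
(** Term 0 is cleared so that sums starting at 1 become series starting at 0; the moment bound [Xc]
    concerns positive indices. *)
Let Y p w := if p is 0 then 0 else X p w.

Let SE n w : S n w = series (Y ^~ w) n.
Proof.
rewrite /partial_sum /series/=; case: n => [|n]; first by rewrite !big_geq.
by rewrite [RHS]big_ltn// add0r; apply: eq_big_nat => -[].
Qed.

Let mY p : measurable_fun setT (Y p).
Proof. by case: p => [|p]; [exact: measurable_cst|exact: mX]. Qed.

(** The sum of absolute values dominates every partial sum. By Tonelli its integral is at most the
    sum of the [c p], so it is finite almost everywhere. *)
Let D w := (\sum_(p <oo) `|Y p w|%:E)%E.

Let D_ge0 w : (0 <= D w)%E.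
Proof. by apply: nneseries_ge0 => p _ _; rewrite lee_fin. Qed.

Let iD : P.-integrable setT D.
Proof.
have mnY p : measurable_fun setT (fun w => `|Y p w|%:E).
  by apply/measurable_EFinP; exact: measurableT_comp.
apply/integrableP; split.
  by apply: ge0_emeasurable_sum => // p w _ _; rewrite lee_fin.
under eq_integral => w _ do rewrite (gee0_abs (D_ge0 w)).
rewrite integral_nneseries//.
apply: le_lt_trans c_sum.
rewrite nneseries_recl//; last first.
  by move=> p _; apply: integral_ge0 => w _; rewrite lee_fin.
rewrite /= integral0_eq ?add0e; last by move=> w _; rewrite normr0.
rewrite eseries_cond [leRHS]eseries_cond.
apply: lee_nneseries => [p _ _|[//|p] _]; last exact: Xc.
by apply: integral_ge0 => w _; rewrite lee_fin.
Qed.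

Let S_le n w : (`|S n w|%:E <= D w)%E.
Proof.
rewrite SE; apply: (@le_trans _ _ (\sum_(0 <= p < n) `|Y p w|%:E)%E).
  by rewrite sumEFin lee_fin ler_norm_sum.
by apply: nneseries_lim_ge => p _ _; rewrite lee_fin.
Qed.

Lemma random_series_cvg :
  {ae P, forall w, S n w @[n --> \oo] --> limn (S ^~ w)}.
Proof.
have := integrable_ae measurableT iD; apply: filterS => w /(_ Logic.I) Dw.
have -> : S ^~ w = series (Y ^~ w) by apply/funext => n; exact: SE.
apply: normed_cvg; apply: nondecreasing_is_cvgn.
  apply: nondecreasing_series => p _ _; exact: normr_ge0.
exists (fine (D w)) => _ [n _ <-]; rewrite -lee_fin fineK// /series/= -sumEFin.
by apply: nneseries_lim_ge => p _ _; rewrite lee_fin.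
Qed.

Lemma measurable_random_series : measurable_fun setT (fun w => limn (S ^~ w)).
Proof. by apply: measurable_limn => n; exact: measurable_sum. Qed.

(** Dominated convergence with envelope [D]. The weight [W = 1] yields integrability of the
    Hamiltonian, and the Gibbs weight yields its weighted mean. *)
Lemma random_series_dominated (W : T -> R) :
  measurable_fun setT W -> (forall w, 0 <= W w <= 1) ->
  P.-integrable setT (EFin \o (fun w => W w * limn (S ^~ w))) /\
  \int[P]_w (W w * S n w) @[n --> \oo] --> \int[P]_w (W w * limn (S ^~ w)).
Proof.
move=> mW W01.
have mS n : measurable_fun setT (S n) by exact: measurable_sum.
have [|||||iL _ cvgL] := @dominated_convergence _ _ _ P setT measurableT
  (fun n w => (W w * S n w)%:E) (fun w => (W w * limn (S ^~ w))%:E) D.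
- by move=> n; apply/measurable_EFinP; exact: measurable_funM.
- by apply/measurable_EFinP; apply: measurable_funM => //; exact: measurable_random_series.
- apply: filterS random_series_cvg => w Sw _.
  by apply: cvg_EFin; [exact: nearW|apply: cvgM => //; exact: cvg_cst].
- exact: iD.
- apply: aeW => w n _; apply: le_trans (S_le n w).
  rewrite /= lee_fin normrM ler_piMl//.
  by have /andP[? ?] := W01 w; rewrite ger0_norm.
split; first exact: iL.
apply: fine_cvg; rewrite fineK; first exact: cvgL.
exact: integrable_fin_num iL.
Qed.

End random_series.

Lemma Rintegral_cstP d (T : measurableType d) (R : realType)
  (P : probability T R) (c : R) : \int[P]_w c = c.
Proof. by have := expectation_cst P c; rewrite unlock /Rintegral => ->. Qed.

Lemma meanE d (T : measurableType d) (R : realType) (P : probability T R)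
  (f : T -> R) : mean P f = \int[P]_w f w.
Proof. by rewrite /mean unlock. Qed.

Lemma continuous_cosh {R : realType} : continuous (@cosh R).
Proof. exact: (is_derive_continuous is_derive_cosh). Qed.

Lemma continuous_inv_sqr_cosh {R : realType} :
  continuous (fun x : R => (cosh x ^+ 2)^-1).
Proof.
move=> x; apply: cvgV; first exact/lt0r_neq0/exprn_gt0/cosh_gt0.
apply: (@continuous_comp _ _ _ (@cosh R) (fun y : R => y ^+ 2)).
  exact: continuous_cosh.
exact: exprn_continuous.
Qed.

(** * The mean-field functional with a centered Gaussian field *)

Section gaussian_mean_field.
Context d (T : measurableType d) (R : realType) (P : probability T R).
Variable h : {RV P >-> R}.
Hypothesis h_gaussian : is_centered_gaussian h.
Hypothesis h_exp : ('E_P[fun w => expR (2 * `|h w|)] < +oo)%E.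

Let mh : measurable_fun setT h. Proof. exact: measurable_funPT. Qed.

Let mhD t : measurable_fun setT (fun w => t + h w).
Proof. exact: measurable_funD. Qed.

Let msc (g : R -> R) t : continuous g -> measurable_fun setT (fun w => g (t + h w)).
Proof.
by move=> cg; apply: (measurableT_comp (continuous_measurable_fun cg)).
Qed.

Lemma integrable_exp_norm : P.-integrable setT (EFin \o (fun w => expR (2 * `|h w|))).
Proof.
apply/integrableP; split.
  apply/measurable_EFinP; apply: measurableT_comp => //; apply: measurable_funM => //.
  exact: measurableT_comp.
move: h_exp; rewrite unlock; apply: le_lt_trans.
by under eq_integral => x _ do (simpl; rewrite (ger0_norm (expR_ge0 _))).
Qed.

Lemma integrable_gaussian : P.-integrable setT (EFin \o h).
Proof.
apply: le_integrable integrable_exp_norm => //; first exact/measurable_EFinP.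
move=> w _ /=; rewrite lee_fin (ger0_norm (expR_ge0 _)).
apply: le_trans (expR_ge1Dx _); have := normr_ge0 (h w); lra.
Qed.

Lemma integrable_ln_cosh t : P.-integrable setT (EFin \o (fun w => ln (cosh (t + h w)))).
Proof.
have ih : P.-integrable setT (EFin \o (fun w => `|t| + `|h w|)).
  have i1 : P.-integrable setT (EFin \o cst `|t|) by exact: finite_measure_integrable_cst.
  exact: (integrableD measurableT i1 (integrable_norm integrable_gaussian)).
apply: le_integrable ih => //.
  apply/measurable_EFinP.
  exact: (@msc (fun x => ln (cosh x)) t (is_derive_continuous is_derive_ln_cosh)).
move=> w _ /=; rewrite lee_fin ger0_norm ?ln_cosh_ge0// ger0_norm ?addr_ge0//.
by rewrite (le_trans (ln_cosh_le_norm _))// ler_normD.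
Qed.

Lemma integrable_tanh t : P.-integrable setT (EFin \o (fun w => tanh (t + h w))).
Proof.
apply: (@bounded_integrable _ _ _ _ _ 1) => [|w]; last exact: norm_tanh_le1.
exact: (@msc (@tanh R) t (is_derive_continuous is_derive_tanh)).
Qed.

Lemma integrable_inv_sqr_cosh t :
  P.-integrable setT (EFin \o (fun w => (cosh (t + h w) ^+ 2)^-1)).
Proof.
apply: (@bounded_integrable _ _ _ _ _ 1) => [|w].
  exact: (@msc (fun x => (cosh x ^+ 2)^-1) t continuous_inv_sqr_cosh).
by have /andP[? ?] := inv_sqr_cosh_le1 (t + h w); rewrite ger0_norm.
Qed.

(** Differentiation under the integral sign; the bound on [df] makes the constant 1 a dominating
    function. It is applied to [ln cosh] and then to [tanh]. *)
Let is_derive_translate (f df : R -> R) (t : R) :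
  (forall x : R, is_derive x 1 f (df x)) -> (forall x, `|df x| <= 1) ->
  (forall t, P.-integrable setT (EFin \o (fun w => f (t + h w)))) ->
  is_derive t 1 (fun t => \int[P]_w f (t + h w)) (\int[P]_w df (t + h w)).
Proof.
move=> fdf df1 intf.
have dft (x : R) w : is_derive x 1 (fun x => f (x + h w)) (df (x + h w)).
  have d1 := fdf (x + h w).
  have -> : (fun x => f (x + h w)) = f \o (id + cst (h w)) by [].
  by apply: is_derive_eq; rewrite addr0 mulr1.
have It : `]t - 1, t + 1[%classic t by rewrite /= in_itv/= ltrBlDr ltrDl ltr01.
have d1E (x : R) w : partial1of2 (fun x w => f (x + h w)) x w = df (x + h w).
  by rewrite partial1of2E; exact: derive_val.
pose G := @cst T R 1.
have dx1 x w : `]t - 1, t + 1[%classic x -> setT w -> derivable (fun x => f (x + h w)) x 1.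
  by move=> _ _; have [] := dft x w.
have G1 x w : `]t - 1, t + 1[%classic x -> setT w ->
    `|partial1of2 (fun x w => f (x + h w)) x w| <= G w by rewrite d1E.
have iG : P.-integrable setT (EFin \o G) by exact: finite_measure_integrable_cst.
have G0 w : 0 <= G w by exact: ler01.
have intI x : `]t - 1, t + 1[%classic x -> P.-integrable setT (EFin \o (fun w => f (x + h w))).
  by move=> _; exact: intf.
apply: DeriveDef.
  exact: (derivable_under_integral measurableT It intI dx1 G0 iG G1).
rewrite -derive1E (differentiation_under_integral measurableT It intI dx1 G0 iG G1).
by apply: eq_Rintegral => w _; rewrite d1E.
Qed.

(** [L], [psi] and [chi] are the potential and its two derivatives to which the abstract mean-field
    lemmas are applied; [alpha] is [1 / chi 0]. *)
Let L t := \int[P]_w ln (cosh (t + h w)).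
Let psi t := \int[P]_w tanh (t + h w).
Let chi t := \int[P]_w (cosh (t + h w) ^+ 2)^-1.

Let dL (t : R) : is_derive t 1 L (psi t).
Proof.
apply: is_derive_translate.
  exact: norm_tanh_le1.
exact: integrable_ln_cosh.
Qed.

Let dpsi (t : R) : is_derive t 1 psi (chi t).
Proof.
apply: is_derive_translate => [x|].
  by have /andP[? ?] := inv_sqr_cosh_le1 x; rewrite ger0_norm.
exact: integrable_tanh.
Qed.

(** With [c] the midpoint and [r] the half-gap of [x] and [y], [chi x - chi y = E G (c + h)] for an
    odd function [G], bounded by 1 and positive on the positive axis; [0 <= x < y] gives [c > 0], so
    [gaussian_odd_gt0] applies. *)
Let chi_decr x y : 0 <= x -> x < y -> chi y < chi x.
Proof.
move=> x0 xy; rewrite -subr_gt0 -RintegralB ?integrable_inv_sqr_cosh//.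
pose c := (x + y) / 2; pose r := (y - x) / 2.
have r0 : 0 < r by rewrite divr_gt0// subr_gt0.
have c0 : 0 < c by rewrite divr_gt0//; lra.
pose G z : R := (cosh (z - r) ^+ 2)^-1 - (cosh (z + r) ^+ 2)^-1.
have := @gaussian_odd_gt0 _ _ _ _ h G c h_gaussian c0.
have -> : \int[P]_w G (c + h w) =
    \int[P]_w ((cosh (x + h w) ^+ 2)^-1 - (cosh (y + h w) ^+ 2)^-1).
  apply: eq_Rintegral => w _; rewrite /G /c /r.
  by congr ((cosh _ ^+ 2)^-1 - (cosh _ ^+ 2)^-1); field.
apply.
- move=> z; apply: cvgB.
    apply: (@continuous_comp _ _ _ (fun z => z - r) (fun x : R => (cosh x ^+ 2)^-1)).
      by apply: cvgB; [exact: cvg_id|exact: cvg_cst].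
    exact: continuous_inv_sqr_cosh.
  apply: (@continuous_comp _ _ _ (fun z => z + r) (fun x : R => (cosh x ^+ 2)^-1)).
    by apply: cvgD; [exact: cvg_id|exact: cvg_cst].
  exact: continuous_inv_sqr_cosh.
- move=> z; rewrite /G.
  have -> : - z - r = - (z + r) by ring.
  have -> : - z + r = - (z - r) by ring.
  by rewrite !coshN opprB.
- move=> z; rewrite /G.
  have /andP[? ?] := inv_sqr_cosh_le1 (z - r).
  have /andP[? ?] := inv_sqr_cosh_le1 (z + r).
  by rewrite ler_norml; apply/andP; split; lra.
- by move=> z z0; rewrite subr_gt0 inv_sqr_cosh_lt.
Qed.

Let chi_gt0 x : 0 <= x -> 0 < chi x.
Proof.
move=> x0; apply: (@le_lt_trans _ _ (chi (x + 1))); last by rewrite chi_decr ?ltrDl.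
by apply: Rintegral_ge0 => w _; have /andP[] := inv_sqr_cosh_le1 (x + 1 + h w).
Qed.

Let psi0 : psi 0 = 0.
Proof.
have := centered_gaussian_symmetric h_gaussian
  (continuous_measurable_fun (is_derive_continuous (@is_derive_tanh R))).
move=> /(congr1 fine); rewrite -!/(Rintegral _ _ _).
have -> : \int[P]_w tanh (- h w) = - psi 0.
  rewrite -mulN1r -RintegralZl ?integrable_tanh//.
  by apply: eq_Rintegral => w _; rewrite add0r mulN1r tanhN.
have -> : \int[P]_w tanh (h w) = psi 0.
  by apply: eq_Rintegral => w _; rewrite add0r.
lra.
Qed.

Let psi_mono : {homo psi : x y / x <= y}.
Proof.
move=> x y; rewrite le_eqVlt => /predU1P[->//|xy].
have [c _ cE] := MVT_real dpsi xy.
rewrite -subr_ge0 cE mulr_ge0 ?subr_ge0 ?(ltW xy)//.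
by apply: Rintegral_ge0 => w _; have /andP[] := inv_sqr_cosh_le1 (c + h w).
Qed.

(** Since [1 - psi M <= 2 e^(-2M) K], the choice [M = K / (1 - u)] suffices by [e^(2M) >= 1 + 2M].
    This supplies the upper end for the intermediate value theorem in [mean_field_maximizer]. *)
Let psi_large u : u < 1 -> exists2 M, 0 <= M & u <= psi M.
Proof.
move=> u1; pose K := \int[P]_w expR (2 * `|h w|).
have K0 : 0 <= K by apply: Rintegral_ge0 => w _; exact: expR_ge0.
pose M := K / (1 - u).
have M0 : 0 <= M by rewrite divr_ge0// subr_ge0 ltW.
have e0 : expR (- (2 * M)) * K <= (1 - u) / 2.
  rewrite expRN mulrC ler_pdivrMr ?expR_gt0//.
  have -> : K = M * (1 - u) by rewrite divfK// subr_eq0 gt_eqF.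
  have := expR_ge1Dx (2 * M) => eM.
  have := mulr_ge0 (_ : 0 <= 1 - u) (_ : 0 <= expR (2 * M) - (1 + 2 * M)).
  by rewrite !subr_ge0 eM (ltW u1) => /(_ isT isT); lra.
exists M => //; rewrite -lerN2 -(lerD2l 1).
have -> : 1 - psi M = \int[P]_w (1 - tanh (M + h w)).
  rewrite RintegralB ?integrable_tanh//; last exact: finite_measure_integrable_cst.
  by rewrite Rintegral_cstP.
have : \int[P]_w (1 - tanh (M + h w)) <= \int[P]_w (2 * expR (- (2 * M)) * expR (2 * `|h w|)).
  have i1 : P.-integrable setT (EFin \o cst (1 : R)) by exact: finite_measure_integrable_cst.
  apply: le_Rintegral => //.
  - exact: (integrableB measurableT i1 (integrable_tanh M)).
  - exact: (integrableZl measurableT _ integrable_exp_norm).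
  - move=> w _; apply: le_trans (one_sub_tanh_le _) _.
    rewrite -mulrA ler_pM2l// -expRD ler_expR.
    have := ler_norm (- h w); rewrite normrN; lra.
rewrite RintegralZl ?integrable_exp_norm// -/K; lra.
Qed.

Let L_even t : L (- t) = L t.
Proof.
have mt : measurable_fun setT (fun x : R => ln (cosh (t + x))).
  apply: (measurableT_comp (continuous_measurable_fun
    (is_derive_continuous (@is_derive_ln_cosh R)))).
  exact: measurable_funD.
have /(congr1 fine) symE := centered_gaussian_symmetric h_gaussian mt.
transitivity (\int[P]_w ln (cosh (t - h w))); last exact: symE.
by apply: eq_Rintegral => w _; rewrite -coshN opprD opprK.
Qed.

Let fCWE m b : fCW h m b = ln 2 + (L (b * m) - b * m ^+ 2 / 2).
Proof. by rewrite /fCW meanE addrA. Qed.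

Let alphaE : alpha h = (chi 0)^-1.
Proof.
by rewrite /alpha meanE; congr _^-1; apply: eq_Rintegral => w _; rewrite add0r.
Qed.

Lemma fCW_even m b : fCW h (- m) b = fCW h m b.
Proof. by rewrite !fCWE mulrN L_even sqrrN. Qed.

(** By continuity and compactness the set of maximizers is inhabited, so [get] returns one of its
    elements. *)
Lemma mu_ofP b : 0 <= mu_of h b <= 1 /\
  forall m, 0 <= m <= 1 -> fCW h m b <= fCW h (mu_of h b) b.
Proof.
have cL : continuous L by exact: is_derive_continuous dL.
have [|m + mE] := @EVT_max R (fCW h ^~ b) 0 1 ler01.
  apply: continuous_subspaceT => x.
  have -> : fCW h ^~ b = fun m => ln 2 + (L (b * m) - b * m ^+ 2 / 2).
    by apply/funext => y; rewrite fCWE.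
  apply: cvgD; first exact: cvg_cst.
  apply: cvgB.
    apply: (@continuous_comp _ _ _ (fun m => b * m) L); last exact: cL.
    exact: mulrl_continuous.
  apply: cvgM; last exact: cvg_cst.
  by apply: cvgM; [exact: cvg_cst|exact: exprn_continuous].
rewrite in_itv/= => m01.
apply: (@getPex _ [set m : R | 0 <= m <= 1 /\
  forall m', 0 <= m' <= 1 -> fCW h m' b <= fCW h m b]).
by exists m; split=> // m' m'01; apply: mE; rewrite in_itv.
Qed.

(** [mean_field_maximizer] gives some [b > alpha] at which [u] beats every other [m >= 0] strictly.
    This forces [mu_of h b = u], so the set defining [beta_of] is inhabited. *)
Lemma beta_ofP u : 0 < u < 1 -> alpha h < beta_of h u /\
  forall m, 0 <= m <= 1 -> fCW h m (beta_of h u) <= fCW h u (beta_of h u).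
Proof.
move=> /andP[u0 u1]; have [M M0 uM] := psi_large u1.
have [b ab umax] := mean_field_maximizer dL dpsi psi0 chi_gt0 chi_decr u0 M0 uM.
have mub : mu_of h b = u.
  apply/eqP/negPn/negP => mu; have [/andP[mu0 _] mumax] := mu_ofP b.
  have := umax _ mu0 mu; rewrite ltNge => /negP; apply.
  by have := mumax u; rewrite (ltW u0) (ltW u1) !fCWE lerD2l; apply.
have [abu muE] : alpha h < beta_of h u /\ mu_of h (beta_of h u) = u.
  apply: (@getPex _ [set b : R | alpha h < b /\ mu_of h b = u]).
  by exists b; split => //; rewrite alphaE.
split => // m m01; have [_ /(_ m m01)] := mu_ofP (beta_of h u).
by rewrite muE.
Qed.

(** Evenness reduces to [|m|]; the inequality holds at [beta_of h u], where [u] is a maximizer, and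
    [mean_field_monotone] carries it to the larger [b]. *)
Lemma fCW_le u b m : 0 < u < 1 -> beta_of h u < b -> `|m| <= u ->
  fCW h m b <= fCW h u b.
Proof.
move=> u01 bub mu; have [abu umax] := beta_ofP u01.
have -> : fCW h m b = fCW h `|m| b.
  by have [//|_] := ger0P m; rewrite fCW_even.
rewrite !fCWE lerD2l.
apply: (mean_field_monotone dL psi_mono _ (ltW bub)).
- by rewrite (lt_trans _ abu)// alphaE invr_gt0 chi_gt0.
- by rewrite normr_ge0.
- have := umax `|m|; rewrite !fCWE lerD2l; apply.
  by rewrite normr_ge0 (le_trans mu)//; case/andP: u01 => _ /ltW.
Qed.

End gaussian_mean_field.

(** * Summability of the coupling strengths *)

Section coupling_strengths.
Context {R : realType}.
Variables (bs : nat -> R).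
Hypothesis bs_sum : (\sum_(1 <= p <oo) (2 ^+ p * bs p ^+ 2)%:E < +oo)%E.

Let expn2_ge1 p : 1 <= 2 ^+ p :> R.
Proof. by rewrite exprn_ege1// ler1n. Qed.

Let term_ge0 p : (0 <= (2 ^+ p * bs p ^+ 2)%:E)%E.
Proof. by rewrite lee_fin mulr_ge0 ?sqr_ge0// exprn_ge0. Qed.

(** [xi] is a [limn], so its partial sums must first be shown bounded, here by the series weighted
    by [2^p]; a nondecreasing convergent sequence stays below its limit. *)
Lemma sum_sqr_le_xi n : \sum_(1 <= p < n) bs p ^+ 2 <= xi bs 1.
Proof.
pose u n := \sum_(1 <= p < n) bs p ^+ 2.
have -> : xi bs 1 = limn u.
  rewrite /xi; congr (lim (_ @ \oo)); apply/funext => m.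
  by apply: eq_bigr => p _; rewrite expr1n mulr1.
have u_nd : nondecreasing_seq u.
  apply/nondecreasing_seqP => m; rewrite /u; case: m => [|m].
    by rewrite !big_geq.
  by rewrite [leRHS]big_nat_recr//= lerDl sqr_ge0.
apply: (nondecreasing_cvgn_le u_nd); apply: nondecreasing_is_cvgn => //.
exists (fine (\sum_(1 <= p <oo) (2 ^+ p * bs p ^+ 2)%:E)%E) => _ [m _ <-].
rewrite -lee_fin fineK; last first.
  by rewrite ge0_fin_numE//; apply: nneseries_ge0.
apply: (@le_trans _ _ (\sum_(1 <= p < m) (2 ^+ p * bs p ^+ 2)%:E)%E).
  rewrite sumEFin lee_fin; apply: ler_sum => p _.
  by rewrite ler_peMl ?sqr_ge0.
by apply: nneseries_lim_ge => p _ _.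
Qed.

(* [|b| <= 2^p b^2 / 2 + 2^(-p) / 2] *)
Lemma sum_norm_lty (c : R) : 0 <= c -> (\sum_(1 <= p <oo) (c * `|bs p|)%:E < +oo)%E.
Proof.
move=> c0; pose v p := (c * (2 ^+ p * bs p ^+ 2) + c * 2 ^- p).
have bv p : c * `|bs p| <= v p.
  rewrite /v -mulrDr ler_wpM2l//.
  have := expn2_ge1 p; set q := 2 ^+ p; move=> q1.
  have q0 : 0 < q by exact: lt_le_trans q1.
  have qV : q * q^-1 = 1 by rewrite divff// gt_eqF.
  have qV0 : 0 < q^-1 by rewrite invr_gt0.
  rewrite -(real_normK (num_real (bs p))); set y := `|bs p|.
  have : 0 <= (q * y - 1) ^+ 2 * q^-1 by rewrite mulr_ge0 ?sqr_ge0 ?ltW.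
  have -> : (q * y - 1) ^+ 2 * q^-1 = q * y ^+ 2 - 2 * y + q^-1.
    by field; rewrite gt_eqF.
  by have := normr_ge0 (bs p); rewrite -/y; lra.
have V0 p : 0 <= 2 ^- p :> R by rewrite invr_ge0 exprn_ge0.
have v0 p : (0 <= (v p)%:E)%E.
  by rewrite lee_fin; apply: addr_ge0; rewrite mulr_ge0//; exact: (term_ge0 p).
apply: (@le_lt_trans _ _ (\sum_(1 <= p <oo) (v p)%:E)%E).
  by apply: lee_nneseries => [p _ _|p _]; rewrite lee_fin// mulr_ge0.
rewrite (_ : \sum_(1 <= p <oo) (v p)%:E =
  \sum_(1 <= p <oo) (c%:E * (2 ^+ p * bs p ^+ 2)%:E + c%:E * (2 ^- p)%:E))%E; last first.
  by apply: eq_eseriesr => p _; rewrite /v EFinD !EFinM.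
rewrite nneseriesD//; last 2 first.
  by move=> p _ _; rewrite mule_ge0// lee_fin.
  by move=> p _ _; rewrite mule_ge0// lee_fin.
rewrite !nneseriesZl//.
rewrite lte_add_pinfty// lte_mul_pinfty//.
(* The sum of [1 / 2^(p + 1)] over [p >= 0] is at most 1; shifting the index by one matches it with
   the series starting at 1. *)
have := @epsilon_trick0 R 1 xpredT ler01 => geo.
rewrite -(@nneseries_addn _ (fun p => (2 ^- p)%:E) 1); last first.
  by move=> p; rewrite lee_fin.
apply: le_lt_trans (ltry 1); apply: le_trans geo.
rewrite le_eqVlt; apply/orP; left; apply/eqP; apply: eq_eseriesr => p _.
by rewrite addn1 natrX mul1r.
Qed.

End coupling_strengths.

Section sums_of_integrals.
Context d (T : measurableType d) (R : realType) (P : probability T R).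
Variables (I : Type) (s : seq I) (f : I -> T -> R).
Hypothesis intf : forall i, P.-integrable setT (EFin \o f i).

Lemma integrable_sumR : P.-integrable setT (EFin \o (fun w => \sum_(i <- s) f i w)).
Proof.
apply: (eq_integrable measurableT (fun w => \sum_(i <- s) (f i w)%:E)%E).
  by move=> w _; rewrite sumEFin.
by apply: (integrable_sum measurableT) => i _; exact: intf.
Qed.

Lemma Rintegral_sum : \int[P]_w (\sum_(i <- s) f i w) = \sum_(i <- s) \int[P]_w f i w.
Proof.
rewrite /Rintegral; under eq_integral do rewrite -sumEFin.
rewrite (integral_sum measurableT intf).
rewrite (eq_bigr (fun i => (fine (\int[P]_w (f i w)%:E)%E)%:E)) ?sumEFin// => i _.
by rewrite fineK//; exact: (integrable_fin_num measurableT (intf i)).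
Qed.

End sums_of_integrals.

Lemma same_law_integral d (T : measurableType d) (R : realType) (P : probability T R)
    (X Y : {RV P >-> R}) (f : R -> R) : same_law X Y ->
  measurable_fun setT f -> (forall y, 0 <= f y) ->
  (\int[P]_w (f (X w))%:E = \int[P]_w (f (Y w))%:E)%E.
Proof.
move=> XY mf f0.
have mEf : measurable_fun setT (EFin \o f) by exact/measurable_EFinP.
have Ef0 y : (0 <= (EFin \o f) y)%E by rewrite lee_fin.
have := ge0_integral_distribution X mEf Ef0.
have := ge0_integral_distribution Y mEf Ef0 => /= <- <-.
by apply: eq_measure_integral => A mA _; exact: XY.
Qed.

(** * Two-sided bounds on the free energy at finite [N] *)

Section free_energy_bounds.
Context d (T : measurableType d) (R : realType) (P : probability T R).
Variables (h : {RV P >-> R}) (g : seq nat -> {RV P >-> R}) (hs : nat -> {RV P >-> R}).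
Hypothesis dis : is_disorder h g hs.
Variables (bs : nat -> R).
Hypothesis bs_sum : (\sum_(1 <= p <oo) (2 ^+ p * bs p ^+ 2)%:E < +oo)%E.
Variables (N : nat).
Hypothesis N0 : (0 < N)%N.
Variable x : R.
Notation config := {ffun 'I_N -> bool}.
Implicit Type sigma : config.

Let term sigma p w := bs p / N%:R `^ (p%:R - 2^-1) *
  \sum_(t : (2 * p).-tuple 'I_N) g [seq val i | i <- t] w * \prod_(i <- t) spin R sigma i.

Notation H sigma w := (HSK g bs sigma w).

Let termE sigma p w :
  term sigma p w = \sum_(k <- words_of_size N p) coef bs sigma k * g k w.
Proof.
rewrite big_map big_enum /term mulr_sumr; apply: eq_bigr => t _.
by rewrite coefE -[RHS]mulrA [X in _ = _ * X]mulrC.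
Qed.

Let partial_sumE sigma n w :
  partial_sum (term sigma) n w = \sum_(k <- words N n) coef bs sigma k * g k w.
Proof.
rewrite big_flatten big_map; apply: eq_bigr => p _; exact: termE.
Qed.

Let mterm sigma p : measurable_fun setT (term sigma p).
Proof.
apply: measurable_funM; first exact: measurable_cst.
apply: measurable_sum => t.
apply: measurable_funM; [exact: measurable_funPT|exact: measurable_cst].
Qed.

Let words_coupling p k : (0 < p)%N -> k \in words_of_size N p -> coupling_word k.
Proof.
by move=> p0 /size_words_of_size kp; rewrite /coupling_word kp oddM/= muln_gt0 p0.
Qed.

Let sum_sqr_coef sigma p :
  \sum_(k <- words_of_size N p) coef bs sigma k ^+ 2 = N%:R * bs p ^+ 2.
Proof. by rewrite big_map big_enum -(sum_coef_sqr bs sigma p N0). Qed.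

Let expR_term sigma p (e : R) : (0 < p)%N ->
  (\int[P]_w (expR (e * term sigma p w))%:E = (expR (e ^+ 2 * (N%:R * bs p ^+ 2) / 2))%:E)%E.
Proof.
move=> p0; have one01 (i : nat) (y : R) : 0 <= cst (1 : R) y <= 1 by rewrite /= ler01 lexx.
(* With zero sites the field weight is an empty product equal to 1, which leaves the couplings
   alone. *)
have := @disorder_mgf _ _ _ _ _ _ _ dis 0 (fun=> cst 1) (fun=> measurable_cst _)
  one01 (words_of_size N p) (fun k => e * coef bs sigma k)
  (uniq_words_of_size _ _) (fun k => words_coupling p0).
under [in X in _ = (_ * (expR (X / 2))%:E)%E -> _]eq_bigr do rewrite exprMn.
rewrite -mulr_sumr sum_sqr_coef.
have -> : (\int[P]_w (field_weight hs 0 (fun=> cst 1) w)%:E = 1)%E.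
  under eq_integral do rewrite /field_weight big_ord0.
  by have := expectation_cst P 1; rewrite unlock.
rewrite mul1e => <-; apply: eq_integral => w _.
rewrite /field_weight big_ord0 mul1r termE mulr_sumr; congr (expR _)%:E.
by apply: eq_bigr => k _; rewrite mulrA.
Qed.

(* [|X| <= b (e^(X/b) + e^(-X/b))] with [b] the modulus of [bs p], for which both
   exponential moments equal [e^(N/2)] *)
Let norm_term sigma p : (0 < p)%N ->
  (\int[P]_w `|term sigma p w|%:E <= (2 * expR (N%:R / 2) * `|bs p|)%:E)%E.
Proof.
move=> p0; have [b0|b0] := eqVneq (bs p) 0.
  rewrite b0 normr0 mulr0 integral0_eq// => w _.
  by rewrite /term b0 !mul0r normr0.
have nb0 : 0 < `|bs p| by rewrite normr_gt0.
pose a := `|bs p|^-1.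
have ea (e : R) : e ^+ 2 = a ^+ 2 ->
    (\int[P]_w (expR (e * term sigma p w))%:E = (expR (N%:R / 2))%:E)%E.
  move=> ea; rewrite expR_term// ea; congr (expR _)%:E.
  by rewrite -(real_normK (num_real (bs p))) /a; field; rewrite gt_eqF.
have mexp (e : R) : measurable_fun setT (fun w => expR (e * term sigma p w)).
  by apply: measurableT_comp => //; exact: measurable_funM.
apply: (@le_trans _ _ (\int[P]_w (`|bs p| * (expR (a * term sigma p w) +
    expR (- a * term sigma p w)))%:E)%E).
  apply: ge0_le_integral => //.
  - by apply/measurable_EFinP; exact: measurableT_comp.
  - by apply/measurable_EFinP; apply: measurable_funM => //; exact: measurable_funD.
  - move=> w _; rewrite lee_fin -ler_pdivrMl// -/a.
    have a0 : 0 < a by rewrite invr_gt0.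
    rewrite -(gtr0_norm a0) -normrM (gtr0_norm a0) ler_norml mulNr.
    set y := a * _; have := expR_ge1Dx y; have := expR_ge1Dx (- y).
    by have := expR_gt0 y; have := expR_gt0 (- y); lra.
under eq_integral do rewrite EFinM EFinD.
rewrite ge0_integralZl//; last 2 first.
- by apply: emeasurable_funD; exact/measurable_EFinP.
- by move=> w _; rewrite adde_ge0// lee_fin expR_ge0.
rewrite ge0_integralD//; last 2 first.
- exact/measurable_EFinP.
- exact/measurable_EFinP.
rewrite !ea// ?sqrrN// -EFinD -EFinM lee_fin.
lra.
Qed.

Let norm_sum : (\sum_(1 <= p <oo) (2 * expR (N%:R / 2) * `|bs p|)%:E < +oo)%E.
Proof. by apply: sum_norm_lty => //; rewrite mulr_ge0// expR_ge0. Qed.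

Let mH sigma : measurable_fun setT (fun w => H sigma w).
Proof. exact: (measurable_random_series (mterm sigma)). Qed.

Let H_cvg sigma :
  {ae P, forall w, partial_sum (term sigma) n w @[n --> \oo] --> H sigma w}.
Proof. exact: (random_series_cvg (mterm sigma) (norm_term sigma) norm_sum). Qed.

Let HW sigma := random_series_dominated (mterm sigma) (norm_term sigma) norm_sum.

Let iH sigma : P.-integrable setT (EFin \o (fun w => H sigma w)).
Proof.
have one01 (w : T) : 0 <= cst (1 : R) w <= 1 by rewrite /= ler01 lexx.
have [+ _] := HW sigma (measurable_cst (1 : R)) one01.
by apply: eq_integrable => // w _ /=; rewrite mul1r.
Qed.

(** The Gibbs probability of the spin of [sigma] at site [i] when the site feels only the field
    [x + y]. *)
Let phi sigma i (y : R) :=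
  expR ((x + y) * site_spin sigma i) / (2 * cosh (x + y)).

Let phi01 sigma i y : 0 <= phi sigma i y <= 1.
Proof.
have c0 : 0 < 2 * cosh (x + y) by apply: mulr_gt0 => //; exact: cosh_gt0.
rewrite /phi (divr_ge0 (expR_ge0 _) (ltW c0)) (ler_pdivrMr _ _ c0) mul1r.
have -> : 2 * cosh (x + y) = expR (x + y) + expR (- (x + y)).
  by rewrite /cosh mulrC divfK.
rewrite /site_spin; case: insubP => [j _ _|_]; last by rewrite mulr1 lerDl expR_ge0.
rewrite /spin; case: ifP => _; first by rewrite mulr1 lerDl expR_ge0.
by rewrite mulrN1 lerDr expR_ge0.
Qed.

Let mphi sigma i : measurable_fun setT (phi sigma i).
Proof.
have mD : measurable_fun setT (fun y : R => x + y) by exact: measurable_funD.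
apply: measurable_funM.
  by apply: measurableT_comp => //; exact: measurable_funM.
have -> : (fun y : R => (2 * cosh (x + y))^-1) =
    (fun z => (2 * cosh z)^-1) \o (fun y => x + y) by [].
apply: measurableT_comp => //; apply: continuous_measurable_fun => z.
apply: cvgV; first by rewrite gt_eqF// mulr_gt0// cosh_gt0.
by apply: cvgM; [exact: cvg_cst|exact: continuous_cosh].
Qed.

Notation weight sigma := (field_weight hs N (phi sigma)).

Let weight01 sigma w : 0 <= weight sigma w <= 1.
Proof. exact: field_weight01. Qed.

Let mweight sigma : measurable_fun setT (weight sigma).
Proof. exact: measurable_field_weight. Qed.

(** The sum over configurations of a product over sites factorizes into one sum over two spin values
    per site, each equal to 1. *)
Let sum_weight w : \sum_sigma weight sigma w = 1.
Proof.
pose F (i : 'I_N) (b : bool) := expR ((x + hs i w) * (if b then 1 else -1)) /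
  (2 * cosh (x + hs i w)).
rewrite (eq_bigr (fun sigma : config => \prod_(i < N) F i (sigma i))); last first.
  by move=> sigma _; apply: eq_bigr => i _; rewrite /phi site_spin_val.
rewrite -(bigA_distr_bigA F) big1// => i _.
rewrite big_bool /F /= mulr1 mulrN1 -mulrDl.
have -> : expR (x + hs i w) + expR (- (x + hs i w)) = 2 * cosh (x + hs i w).
  by rewrite /cosh [RHS]mulrC divfK.
by rewrite divff// mulf_neq0// gt_eqF// cosh_gt0.
Qed.

Let integral_partial_mgf sigma n :
  (\int[P]_w (weight sigma w * expR (partial_sum (term sigma) n w))%:E <=
   \int[P]_w (weight sigma w)%:E * (expR (N%:R * xi bs 1 / 2))%:E)%E.
Proof.
under eq_integral do rewrite partial_sumE.
rewrite (disorder_mgf dis N (mphi sigma) (phi01 sigma) (coef bs sigma)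
  (uniq_words N n) (@coupling_words N n)).
apply: lee_wpmul2l.
  by apply: integral_ge0 => w _; rewrite lee_fin; have /andP[] := weight01 sigma w.
rewrite lee_fin ler_expR ler_pM2r ?invr_gt0//.
rewrite sum_words (eq_bigr (fun p => N%:R * bs p ^+ 2)); last first.
  by move=> p _; exact: sum_coef_sqr.
by rewrite -mulr_sumr ler_wpM2l// sum_sqr_le_xi.
Qed.

(** The bound for partial sums is uniform in [n] and the partial sums converge almost surely, so
    Fatou's lemma transfers it to the limit. *)
Let integral_weight_expH sigma :
  (\int[P]_w (weight sigma w * expR (H sigma w))%:E <=
   \int[P]_w (weight sigma w)%:E * (expR (N%:R * xi bs 1 / 2))%:E)%E.
Proof.
pose f n w := (weight sigma w * expR (partial_sum (term sigma) n w))%:E.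
have mf n : measurable_fun setT (f n).
  apply/measurable_EFinP; apply: measurable_funM => //.
  by apply: measurableT_comp => //; apply: measurable_sum => p.
have f0 n w : (0 <= f n w)%E.
  by rewrite lee_fin mulr_ge0 ?expR_ge0//; have /andP[] := weight01 sigma w.
rewrite (ae_eq_integral (fun w => limn_einf (f ^~ w)))//; first last.
- apply: filterS (H_cvg sigma) => w Hw _.
  have fw : f n w @[n --> \oo] --> (weight sigma w * expR (H sigma w))%:E.
    apply: cvg_EFin; first exact: nearW.
    apply: cvgM; first exact: cvg_cst.
    by apply: continuous_cvg; [exact: continuous_expR|exact: Hw].
  by have [-> _] := cvg_limn_einf_sup fw.
- exact: measurable_limn_einf.
- apply/measurable_EFinP; apply: measurable_funM => //.
  by apply: measurableT_comp => //; exact: mH.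
apply: le_trans (fatou P measurableT mf (fun n w _ => f0 n w)) _.
rewrite limn_einf_lim; apply: lime_le; first exact: is_cvg_einfs.
apply: nearW => n; apply: le_trans (integral_partial_mgf sigma n).
by apply: ereal_inf_lbound; exists n => //=.
Qed.

(** The weight is independent of the centered couplings, so each partial sum has weighted mean 0,
    and dominated convergence keeps this in the limit. *)
Let integral_weight_H sigma : \int[P]_w (weight sigma w * H sigma w) = 0.
Proof.
have [_ cvg0] := HW sigma (mweight sigma) (weight01 sigma).
apply: (cvg_unique _ cvg0) => //.
have -> : (fun n => \int[P]_w (weight sigma w * partial_sum (term sigma) n w)) = cst 0.
  apply/funext => n.
  have iwg k : coupling_word k ->
      P.-integrable setT (EFin \o (fun w => weight sigma w * g k w)).
    move=> ck; apply: integrable_weighted => //.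
    exact: (standard_gaussian_integrable dis ck).
  (* [Rintegral_sum] asks for integrability at every index, including words outside the list; the
     conditional puts 0 where [g k] is not known to be Gaussian. *)
  transitivity (\int[P]_w \sum_(k <- words N n)
      (if coupling_word k then coef bs sigma k * (weight sigma w * g k w) else 0)).
    apply: eq_Rintegral => w _; rewrite partial_sumE mulr_sumr.
    by apply: eq_big_seq => k kn; rewrite (coupling_words kn) mulrCA.
  rewrite Rintegral_sum => [|k].
    apply: big1_seq => k /andP[_ /coupling_words ck]; rewrite ck.
    by rewrite RintegralZl ?iwg// (disorder_centered dis N (mphi sigma) (phi01 sigma) ck) mulr0.
  have [ck|_] := boolP (coupling_word k); first exact: (integrableZl measurableT _ (iwg _ ck)).
  exact: integrable0.
exact: cvg_cst.
Qed.

(** The partition function relative to that of the fields alone, a weighted mean of [e^H]. The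
    envelope [M] of the next line bounds [|ln Y|] and makes it integrable. *)
Let Y w := \sum_sigma weight sigma w * expR (H sigma w).
Let M w := \sum_(sigma : config) `|H sigma w|.

Let Y_bounds w : expR (- M w) <= Y w <= expR (M w).
Proof.
have HM sigma : `|H sigma w| <= M w.
  by rewrite /M (bigD1 sigma)//= lerDl sumr_ge0.
have wE a : expR a = \sum_sigma weight sigma w * expR a.
  by rewrite -mulr_suml sum_weight mul1r.
rewrite /Y (wE (- M w)) (wE (M w)); apply/andP; split; apply: ler_sum => sigma _.
  apply: ler_wpM2l; first by have /andP[] := weight01 sigma w.
  by rewrite ler_expR; have := HM sigma; rewrite ler_norml => /andP[].
apply: ler_wpM2l; first by have /andP[] := weight01 sigma w.
by rewrite ler_expR; have := HM sigma; rewrite ler_norml => /andP[].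
Qed.

Let Y_gt0 w : 0 < Y w.
Proof. by have /andP[+ _] := Y_bounds w; apply: lt_le_trans; exact: expR_gt0. Qed.

Let ln_Y_bound w : `|ln (Y w)| <= M w.
Proof.
have /andP[lo hi] := Y_bounds w; rewrite ler_norml; apply/andP; split.
  by rewrite -ler_expR lnK ?posrE.
by rewrite -ler_expR lnK ?posrE.
Qed.

(* Jensen: with [m] the weighted mean of the exponents, [e^H >= e^m (1 + H - m)]. *)
Let ln_Y_ge w : \sum_sigma weight sigma w * H sigma w <= ln (Y w).
Proof.
set m := \sum_sigma _; rewrite -ler_expR lnK ?posrE//.
have -> : expR m = \sum_sigma weight sigma w * (expR m * (1 + (H sigma w - m))).
  under eq_bigr do rewrite mulrCA mulrDr mulr1 mulrBr.
  rewrite -mulr_sumr big_split/= sumrB -mulr_suml sum_weight mul1r -/m subrr addr0.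
  by rewrite mulr1.
apply: ler_sum => sigma _; apply: ler_wpM2l.
  by have /andP[] := weight01 sigma w.
rewrite -[H sigma w in leRHS](subrKC m) expRD ler_pM2l ?expR_gt0//.
exact: expR_ge1Dx.
Qed.

Let mY : measurable_fun setT Y.
Proof.
apply: measurable_sum => sigma; apply: measurable_funM => //.
by apply: measurableT_comp => //; exact: mH.
Qed.

Let iM : P.-integrable setT (EFin \o M).
Proof. by apply: integrable_sumR => sigma; exact: (integrable_norm (iH sigma)). Qed.

Let i_ln_Y : P.-integrable setT (EFin \o (fun w => ln (Y w))).
Proof.
apply: le_integrable iM => //.
  by apply/measurable_EFinP; apply: measurableT_comp.
move=> w _ /=; rewrite lee_fin (le_trans (ln_Y_bound w))//; exact: ler_norm.
Qed.

Let integral_ln_Y_ge0 : 0 <= \int[P]_w ln (Y w).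
Proof.
have iwH sigma : P.-integrable setT (EFin \o (fun w => weight sigma w * H sigma w)).
  by have [] := HW sigma (mweight sigma) (weight01 sigma).
have <- : \int[P]_w (\sum_sigma weight sigma w * H sigma w) = 0.
  by rewrite Rintegral_sum// big1// => sigma _; exact: integral_weight_H.
by apply: le_Rintegral => //; exact: integrable_sumR.
Qed.

(* Jensen: [ln y <= y / c - 1 + ln c] at [c = e^(N xi(1) / 2)], which bounds [E Y]. *)
Let integral_ln_Y_le : \int[P]_w ln (Y w) <= N%:R * xi bs 1 / 2.
Proof.
set a := N%:R * xi bs 1 / 2; set c := expR a.
have c0 : 0 < c by exact: expR_gt0.
have iweight sigma : P.-integrable setT (EFin \o weight sigma).
  apply: (@bounded_integrable _ _ _ _ _ 1) => // w.
  by have /andP[? ?] := weight01 sigma w; rewrite ger0_norm.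
have EY : (\int[P]_w (Y w)%:E <= c%:E)%E.
  have wexp0 sigma w : (0 <= (weight sigma w * expR (H sigma w))%:E)%E.
    by rewrite lee_fin mulr_ge0 ?expR_ge0//; have /andP[] := weight01 sigma w.
  rewrite /Y; under eq_integral do rewrite -sumEFin.
  rewrite ge0_integral_sum//; last first.
    move=> sigma; apply/measurable_EFinP; apply: measurable_funM => //.
    by apply: measurableT_comp => //; exact: mH.
  apply: (@le_trans _ _ (\sum_sigma (\int[P]_w (weight sigma w)%:E * c%:E))%E).
    by apply: lee_sum => sigma _; exact: integral_weight_expH.
  rewrite -ge0_sume_distrl; last first.
    move=> sigma _; apply: integral_ge0 => w _; rewrite lee_fin.
    by have /andP[] := weight01 sigma w.
  rewrite -(integral_sum measurableT iweight).
  under eq_integral do rewrite sumEFin sum_weight.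
  by have := expectation_cst P 1; rewrite unlock => ->; rewrite mul1e.
have iY : P.-integrable setT (EFin \o Y).
  apply/integrableP; split; first exact/measurable_EFinP.
  apply: le_lt_trans (ltry c); apply: le_trans EY.
  by under eq_integral => w _ do (simpl; rewrite (gtr0_norm (Y_gt0 w))).
have lnY w : ln (Y w) <= c^-1 * Y w + (a - 1).
  have cY : 0 < c^-1 * Y w by rewrite mulr_gt0 ?invr_gt0.
  rewrite -[Y w in leLHS](mulVKf (lt0r_neq0 c0)) lnM ?posrE// expRK.
  have := @le_ln1Dx R (c^-1 * Y w - 1).
  rewrite subrKC ltrBrDl subrr => /(_ cY); lra.
have i1 : P.-integrable setT (EFin \o cst (a - 1)) by exact: finite_measure_integrable_cst.
have iZ : P.-integrable setT (EFin \o (fun w => c^-1 * Y w)).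
  exact: (integrableZl measurableT c^-1 iY).
apply: (@le_trans _ _ (\int[P]_w (c^-1 * Y w + (a - 1)))).
  apply: le_Rintegral => //.
  exact: (integrableD measurableT iZ i1).
rewrite RintegralD// RintegralZl// Rintegral_cstP.
have : \int[P]_w Y w <= c.
  by rewrite -lee_fin fineK//; exact: (integrable_fin_num measurableT iY).
rewrite -(ler_pM2l (_ : 0 < c^-1)) ?invr_gt0// mulVf ?gt_eqF//; lra.
Qed.

Let partition_functionE w :
  \sum_(sigma : config) expR (H sigma w + \sum_(i < N) (x + hs i w) * spin R sigma i) =
  (\prod_(i < N) (2 * cosh (x + hs i w))) * Y w.
Proof.
rewrite mulr_sumr; apply: eq_bigr => sigma _.
rewrite expRD expR_sum mulrC mulrA; congr (_ * _).
rewrite /field_weight -big_split/=; apply: eq_bigr => i _.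
by rewrite /phi site_spin_val [RHS]mulrC divfK// mulf_neq0// gt_eqF// cosh_gt0.
Qed.

Hypothesis ln_cosh_h : P.-integrable setT (EFin \o (fun w => ln (cosh (x + h w)))).

Let ln_cosh_hs i :
  P.-integrable setT (EFin \o (fun w => ln (cosh (x + hs i w)))) /\
  \int[P]_w ln (cosh (x + hs i w)) = \int[P]_w ln (cosh (x + h w)).
Proof.
pose f (y : R) := ln (cosh (x + y)).
have f0 y : 0 <= f y by exact: ln_cosh_ge0.
have mf : measurable_fun setT f.
  apply: (measurableT_comp (continuous_measurable_fun
    (is_derive_continuous (@is_derive_ln_cosh R)))).
  exact: measurable_funD.
have [_ _ /(_ i) lawi] := dis.
have fE := same_law_integral lawi mf f0.
split; last by rewrite /Rintegral fE.
apply/integrableP; split.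
  by apply/measurable_EFinP; exact: (measurableT_comp mf).
under eq_integral => w _ do (simpl; rewrite (ger0_norm (f0 (hs i w)))).
rewrite fE; move/integrableP : ln_cosh_h => [_].
by under eq_integral => w _ do (simpl; rewrite (ger0_norm (f0 (h w)))).
Qed.

(** The logarithm of the factorized partition function is a sum over sites, each of mean
    [ln 2 + E ln cosh (x + h)], plus [ln Y]; the couplings enter through [E ln Y / N] alone. *)
Let free_energyE : free_energy g hs bs x N =
  ln 2 + \int[P]_w ln (cosh (x + h w)) + N%:R^-1 * \int[P]_w ln (Y w).
Proof.
have NR : N%:R != 0 :> R by rewrite pnatr_eq0 -lt0n.
pose f i w := ln 2 + ln (cosh (x + hs i w)).
have i2 : P.-integrable setT (EFin \o cst (ln 2 : R)) by exact: finite_measure_integrable_cst.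
have if_ i : P.-integrable setT (EFin \o f i).
  exact: (integrableD measurableT i2 (ln_cosh_hs i).1).
have Ef i : \int[P]_w f i w = ln 2 + \int[P]_w ln (cosh (x + h w)).
  have := RintegralD measurableT i2 (ln_cosh_hs i).1.
  by rewrite Rintegral_cstP (ln_cosh_hs i).2.
rewrite /free_energy meanE.
have -> : \int[P]_w ln (\sum_(sigma : config)
    expR (H sigma w + \sum_(i < N) (x + hs i w) * spin R sigma i)) =
    \int[P]_w (\sum_(i < N) f i w + ln (Y w)).
  apply: eq_Rintegral => w _; rewrite partition_functionE.
  have -> : \prod_(i < N) (2 * cosh (x + hs i w)) = expR (\sum_(i < N) f i w).
    rewrite expR_sum; apply: eq_bigr => i _.
    by rewrite /f expRD !lnK ?posrE ?cosh_gt0//.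
  by rewrite lnM ?posrE ?expR_gt0// expRK.
rewrite RintegralD//; last exact: (integrable_sumR _ (fun i : 'I_N => if_ i)).
rewrite (Rintegral_sum _ (fun i : 'I_N => if_ i)) (eq_bigr _ (fun (i : 'I_N) _ => Ef i)).
by rewrite sumr_const card_ord mulrDr -[(_ + _) *+ N]mulr_natl mulKf.
Qed.

Lemma free_energy_bounds :
  ln 2 + \int[P]_w ln (cosh (x + h w)) <= free_energy g hs bs x N <=
  ln 2 + \int[P]_w ln (cosh (x + h w)) + xi bs 1 / 2.
Proof.
rewrite free_energyE lerDl lerD2l mulr_ge0 ?invr_ge0//=.
by rewrite ler_pdivrMl ?ltr0n// mulrA.
Qed.

End free_energy_bounds.

(** * From the free energy bounds to the location of the maximizers *)

Theorem theorem5 (R : realType) (d : measure_display) (T : measurableType d)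
    (P : probability T R) (h : {RV P >-> R}) (g : seq nat -> {RV P >-> R})
    (hs : nat -> {RV P >-> R})
    (h_gaussian : is_centered_gaussian h)
    (h_small : ('E_P[fun w => expR (2 * `|h w|)] < ((max_ratio R)^-1)%:E)%E)
    (disorder_law : is_disorder h g hs)
    (u : R) (u01 : 0 < u < 1)
    (beta : R) (bs : nat -> R) (Rbeta : Rset h g hs u beta bs) :
  Omega g hs beta bs `<=` `[-1, - u[%classic `|` `]u, 1]%classic.
Proof.
have h_exp : ('E_P[fun w => expR (2 * `|h w|)] < +oo)%E by exact: lt_le_trans h_small (leey _).
have [[_ [[_ bs_sum] beta0 _]] bub xi_small] := Rbeta.
move=> m [/andP[m_ge m_le] [F FSK maxF]].
(* [A] is the annealed field part [f0]. Keeping it abstract leaves the final contradiction as linear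
   arithmetic in the values of [A] and [F]. *)
have [A AE Fbounds] : exists2 A : R -> R,
    forall m, fCW h m beta = A (beta * m) - beta * m ^+ 2 / 2 &
    forall y, A y <= F y <= A y + xi bs 1 / 2.
  exists (fun y => ln 2 + \int[P]_w ln (cosh (y + h w))) => [k|y].
    by rewrite /fCW meanE.
  have bounds : \forall N \near \oo,
      ln 2 + \int[P]_w ln (cosh (y + h w)) <= free_energy g hs bs y N <=
      ln 2 + \int[P]_w ln (cosh (y + h w)) + xi bs 1 / 2.
    (* The finite-size bounds hold from [N = 1] on, which is enough to pass to the limit. *)
    exists 1 => // N N1; apply: (free_energy_bounds disorder_law bs_sum N1).
    exact: integrable_ln_cosh.
  have cF : cvgn (free_energy g hs bs y) by apply/cvg_ex; exists (F y); exact: FSK.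
  rewrite -(cvg_lim (@Rhausdorff R) (FSK y)); apply/andP; split.
    by apply: limr_ge => //; apply: filterS bounds => N /andP[].
  by apply: limr_le => //; apply: filterS bounds => N /andP[].
have [mu01 mumax] := mu_ofP h_exp beta.
have mu11 : -1 <= mu_of h beta <= 1.
  by case/andP: mu01 => ? ->; rewrite andbT; apply: le_trans (lerN10 _) _.
have far : u < `|m|.
  rewrite ltNge; apply/negP => mu.
  have fle := fCW_le h_gaussian h_exp u01 bub mu.
  have := maxF _ mu11.
  have /andP[_ Fm] := Fbounds (beta * m).
  have /andP[Fmu _] := Fbounds (beta * mu_of h beta).
  by move: xi_small fle; rewrite /delta !AE; lra.
have [m0|m0] := leP 0 m.
  by right; rewrite /= in_itv/= m_le andbT -(ger0_norm m0).
by left; rewrite /= in_itv/= m_ge/= ltrNr -(ltr0_norm m0).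
Qed.
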